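(* Let $q$ be a power of an odd prime, let $d\ge 4$ be even, let $j\in\mathbb F_q$ with $j\neq 0$, and let $S_j=\{x\in\mathbb F_q^d: x_1^2+\cdots+x_d^2=j\}$ with normalized surface measure $d\sigma$. Then for every $p$ with $\frac{4d}{3d-2}\le p\le\infty$ there is a constant $C>0$ independent of $q$ such that for all $f:S_j\to\mathbb C$, $$\|(fd\sigma)^\vee\|_{L^4(\mathbb F_q^d,dm)}\le C\,\|f\|_{L^p(S_j,d\sigma)}.$$ Furthermore, this result is sharp: for $1\le p<\frac{4d}{3d-2}$ no such estimate holds with a constant independent of $q$.
   Context: $\chi$ denotes the canonical nontrivial additive character of $\mathbb F_q$. The space $\mathbb F_q^d$ carries counting measure $dm$, so $\|g\|_{L^r(\mathbb F_q^d,dm)}=(\sum_{m\in\mathbb F_q^d}|g(m)|^r)^{1/r}$. For a set $V\subset\mathbb F_q^d$ the normalized surface measure $d\sigma$ gives mass $|V|^{-1}$ to each point of $V$, so $\|f\|_{L^p(V,d\sigma)}=(|V|^{-1}\sum_{x\in V}|f(x)|^p)^{1/p}$ (with the usual max for $p=\infty$), and $(fd\sigma)^\vee(m)=\frac{1}{|V|}\sum_{x\in V}f(x)\chi(m\cdot x)$ for $m\in\mathbb F_q^d$. *)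

(* Defs.v *)
From HB Require Import structures.
From mathcomp Require Import all_boot all_order all_algebra all_field.
From mathcomp Require Import all_classical all_reals.
From mathcomp Require Import ereal exp trigo.
From mathcomp Require Import complex.
Set Implicit Arguments. Unset Strict Implicit. Unset Printing Implicit Defensive.
Import Order.TTheory GRing.Theory Num.Theory.
Local Open Scope ring_scope.

Section FourierRestriction.
Variable R : realType.
Variable F : finFieldType.
Variable d : nat.

Definition charF : nat := pdiv #|F|.
Definition degF : nat := logn charF #|F|.

(* absolute trace F_q -> F_p, as an element of F (lies in the prime field) *)
Definition absTr (x : F) : F := \sum_(i < degF) x ^+ (charF ^ i).

Definition trRep (x : F) : nat :=
  if [pick k : 'I_charF | (k%:R : F) == absTr x] is Some k then val k else 0%N.

Definition chi (x : F) : R[i] :=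
  let t := (2 * pi * (trRep x)%:R / charF%:R)%R in (cos t +i* sin t)%C.

Definition dotv (m x : 'rV[F]_d) : F := \sum_(i < d) m 0 i * x 0 i.

Definition sphere (j : F) : {set 'rV[F]_d} :=
  [set x : 'rV[F]_d | \sum_(i < d) (x 0 i) ^+ 2 == j].

Definition extension (V : {set 'rV[F]_d}) (f : 'rV[F]_d -> R[i]) (m : 'rV[F]_d) : R[i] :=
  (#|V|%:R)^-1 * \sum_(x in V) f x * chi (dotv m x).

Definition norm_dm (r : R) (g : 'rV[F]_d -> R[i]) : R :=
  powR (\sum_(m : 'rV[F]_d) powR (Normc.normc (g m)) r) r^-1.

Definition norm_sigma (V : {set 'rV[F]_d}) (p : \bar R) (f : 'rV[F]_d -> R[i]) : R :=
  match p with
  | EFin r => powR ((#|V|%:R)^-1 * \sum_(x in V) powR (Normc.normc (f x)) r) r^-1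
  | +oo%E => \big[Num.max/0]_(x in V) Normc.normc (f x)
  | -oo%E => 0
  end.

End FourierRestriction.

(* Main.v *)
Require Import Defs.
From HB Require Import structures.
From mathcomp Require Import all_boot all_order all_algebra all_field.
From mathcomp Require Import all_classical all_reals.
From mathcomp Require Import ereal exp trigo.
From mathcomp Require Import complex.
From mathcomp Require Import ring lra zify.
Import Order.TTheory GRing.Theory Num.Theory.
Local Open Scope ring_scope.

(** The fourth power of the L^4 norm of the Fourier transform of [f] is at most q^d times the
    additive energy of [h = |f|], a sum over parallelograms [z, z+u, z+v, z+u+v] with vertices on
    the sphere; such parallelograms are rectangles, i.e. [u.v = 0].
    - If [u] and [v] are both non-isotropic, the chords from [z] determine distinct points of
      projective space, and the point-hyperplane incidence bound (error q^(d/2 - 1)) applies at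
      each [z]; AM-GM on the four vertex weights decouples the fourth vertex.
    - If [u] is isotropic, fix [v] instead: [z] and [z+u] are then collinear points of the quadric
      {|z|^2 = j s^2} of odd dimension d + 1, whose collinearity graph also has error
      q^(d/2 - 1), since the relevant Gauss sums cancel. The main term is energy / q and is
      absorbed on the left.
    The resulting bounds are summed without loss at the endpoint by cutting [h] at two heights:
    large values are controlled by the trivial bound |h|_(4/3)^4, middle and small ones by the
    incidence bounds with the two available forms of AM-GM.
    For sharpness, when -1 is a square, test on a totally isotropic affine subspace of dimension
    d/2 - 1 contained in the sphere of radius 1. *)

Set Implicit Arguments. Unset Strict Implicit. Unset Printing Implicit Defensive.

#[local] Arguments chi : simpl never.

(** * The additive character *)

Section Character.
Variables (R : realType) (F : finFieldType).
Local Notation C := R[i].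
Local Notation p := (charF F).

Definition expi (t : R) : C := (cos t +i* sin t)%C.

Lemma expiD s t : expi (s + t) = expi s * expi t.
Proof. by rewrite /expi cosD sinD; apply/eqP; rewrite eq_complex /= eqxx /= addrC. Qed.

Lemma expi0 : expi 0 = 1.
Proof. by rewrite /expi cos0 sin0. Qed.

Lemma expiXn t n : expi (t * n%:R) = expi t ^+ n.
Proof.
by elim: n => [|n IH]; rewrite ?mulr0 ?expi0 // -natr1 mulrDr mulr1 expiD IH exprSr.
Qed.

Lemma normr_expi t : `|expi t| = 1.
Proof. by rewrite normc_def /= cos2Dsin2 sqrtr1. Qed.

Lemma charF_prime : prime p.
Proof. by rewrite pdiv_prime ?finNzRing_gt1. Qed.

Lemma card_charF : #|F| = (p ^ degF F)%N.
Proof.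
have [r r_pr rF] := finPcharP F; have cardF := card_pprimeChar rF.
have l_gt0 : (0 < logn r #|F|)%N.
  by rewrite -(ltn_exp2l _ _ (prime_gt1 r_pr)) -cardF expn0 finNzRing_gt1.
have rp : p = r.
  by rewrite /charF cardF -(prednK l_gt0) pdiv_pfactor.
by rewrite /degF rp.
Qed.

Lemma degF_gt0 : (0 < degF F)%N.
Proof. by rewrite -(ltn_exp2l _ _ (prime_gt1 charF_prime)) -card_charF expn0 finNzRing_gt1. Qed.

Lemma charF_pchar : p \in [pchar F].
Proof. exact: card_finPcharP card_charF charF_prime. Qed.

Lemma exprDp (x y : F) i : (x + y) ^+ (p ^ i) = x ^+ (p ^ i) + y ^+ (p ^ i).
Proof. by apply: exprDn_pchar; rewrite pnatX pnatE ?charF_prime // charF_pchar. Qed.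

Lemma absTrD (x y : F) : absTr (x + y) = absTr x + absTr y.
Proof. by rewrite /absTr -big_split; apply: eq_bigr => i _ /=; rewrite exprDp. Qed.

(** Frobenius permutes the summands of the trace cyclically; the last wraps around to the first
    since [x ^+ #|F| = x]. *)
Lemma absTr_exp (x : F) : absTr x ^+ p = absTr x.
Proof.
rewrite -{1}(expn1 p) /absTr.
rewrite (big_morph (fun z : F => z ^+ (p ^ 1)) (id1 := 0) (op1 := +%R)); first last.
- by rewrite expr0n expn1 -leqn0 leqNgt prime_gt0 ?charF_prime.
- by move=> a b; rewrite exprDp.
rewrite -(prednK degF_gt0) big_ord_recr big_ord_recl /= expn0 expr1 addrC.
rewrite -exprM -expnD addn1 prednK ?degF_gt0 // -card_charF expf_card; congr (_ + _).
by apply: eq_bigr => i _; rewrite -exprM -expnD addn1.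
Qed.

Lemma natr_eq_mod m n : ((m%:R : F) == n%:R) = (m == n %[mod p])%N.
Proof.
wlog le_mn : m n / (m <= n)%N.
  move=> H; case: (leqP m n) => [|/ltnW] /H // E.
  by rewrite eq_sym E eq_sym.
by rewrite eq_sym -subr_eq0 -natrB // -(dvdn_pcharf charF_pchar) eq_sym eqn_mod_dvd.
Qed.

(** ['X^p - 'X] has at most [p] roots, and the residues [0, ..., p - 1] already supply that many. *)
Lemma prime_subfield (y : F) : y ^+ p = y -> exists k : 'I_p, (k%:R : F) == y.
Proof.
move=> yp; apply/existsP; apply: contraT; rewrite negb_exists => /forallP noy.
pose P : {poly F} := 'X^p - 'X.
have sP : size P = p.+1.
  by rewrite size_polyDl size_polyXn // size_polyN size_polyX ltnS prime_gt1 ?charF_prime.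
have P0 : P != 0 by rewrite -size_poly_eq0 sP.
have := @max_poly_roots _ P (y :: [seq (val k)%:R | k : 'I_p <- enum 'I_p]) P0.
rewrite /= size_map size_enum_ord sP ltnn => H; suff: false by [].
apply: H.
  apply/andP; split; first by rewrite rootE !hornerE yp subrr.
  apply/allP => _ /mapP[k _ ->]; rewrite rootE !hornerE.
  by rewrite -(pFrobenius_autE charF_pchar) rmorph_nat subrr.
rewrite map_inj_uniq ?enum_uniq ?andbT.
  by apply/mapP => -[k _ e]; have := noy k; rewrite e eqxx.
move=> a b /eqP; rewrite natr_eq_mod !modn_small // => /eqP; exact: val_inj.
Qed.

Lemma trRepE (x : F) : (trRep x)%:R = absTr x.
Proof.
rewrite /trRep; case: pickP => [k /eqP // | no].
by have [k] := prime_subfield (absTr_exp x); rewrite no.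
Qed.

Lemma trRep_lt (x : F) : (trRep x < p)%N.
Proof. by rewrite /trRep; case: pickP => [k _|_]; [exact: (ltn_ord k) | exact: prime_gt0 charF_prime]. Qed.

Definition zetaF : C := expi (2 * pi / p%:R).

Lemma zetaF_p : zetaF ^+ p = 1.
Proof.
have p0 : p%:R != 0 :> R by rewrite pnatr_eq0 -lt0n prime_gt0 ?charF_prime.
by rewrite -expiXn divfK // mulr_natl /expi cos2pi sin2pi.
Qed.

Lemma zetaF_neq1 n : (0 < n < p)%N -> zetaF ^+ n != 1.
Proof.
case/andP=> n0 np; rewrite -expiXn.
have p0 : 0 < p%:R :> R by rewrite ltr0n prime_gt0 ?charF_prime.
pose s := pi * n%:R / p%:R : R.
have -> : 2 * pi / p%:R * n%:R = s *+ 2 :> R by rewrite /s; field; rewrite gt_eqF.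
have s0 : 0 < sin s.
  apply: sin_gt0_pi; rewrite /s divr_gt0 ?mulr_gt0 ?pi_gt0 ?p0 ?ltr0n //=.
  by rewrite ltr_pdivrMr // ltr_pM2l ?pi_gt0 // ltr_nat.
apply/eqP => /(congr1 (@complex.Re R)) /=; rewrite cos_mulr2n cos2sin2 => H.
have : sin s ^+ 2 = 0 by lra.
by move/eqP; rewrite expf_eq0 /= gt_eqF.
Qed.

Lemma chiE (x : F) : chi R x = zetaF ^+ trRep x.
Proof. by rewrite /chi -expiXn mulrAC. Qed.

Lemma chiD (x y : F) : chi R (x + y) = chi R x * chi R y.
Proof.
rewrite !chiE -exprD -[RHS](expr_mod _ zetaF_p); congr (_ ^+ _).
rewrite -(modn_small (trRep_lt (x + y))); apply/eqP.
by rewrite -natr_eq_mod natrD !trRepE absTrD.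
Qed.

Lemma normr_chi (x : F) : `|chi R x| = 1.
Proof. exact: normr_expi. Qed.

Lemma chi_neq0 (x : F) : chi R x != 0.
Proof. by rewrite -normr_eq0 normr_chi oner_eq0. Qed.

Lemma chi0 : chi R (0 : F) = 1.
Proof. by apply: (mulfI (chi_neq0 0)); rewrite -chiD addr0 mulr1. Qed.

Lemma chiN (x : F) : chi R (- x) = (chi R x)^*%C.
Proof.
apply: (mulfI (chi_neq0 x)); rewrite -chiD subrr chi0 -sqr_normc.
by rewrite normr_chi expr1n.
Qed.

(** As a polynomial the trace has coefficient 1 at ['X] and degree at most
    [p ^ (degF F - 1) < #|F|], so it cannot vanish on all of [F]. *)
Lemma absTr_neq0 : exists x : F, absTr x != 0.
Proof.
apply/existsP; apply: contraT; rewrite negb_exists => /forallP H.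
pose P : {poly F} := \sum_(i < degF F) 'X^(p ^ i).
have sP : (size P <= p ^ (degF F).-1 + 1)%N.
  rewrite (leq_trans (size_sum _ _ _)) //; apply/bigmax_leqP => i _.
  rewrite size_polyXn addn1 ltnS leq_exp2l ?prime_gt1 ?charF_prime //.
  by rewrite -ltnS prednK ?degF_gt0.
have P0 : P != 0.
  have : P`_1 = 1.
    rewrite /P coef_sum (bigD1 (Ordinal degF_gt0)) //= coefXn expn0 eqxx.
    rewrite big1 ?addr0 // => i i0; rewrite coefXn.
    case: eqP => // /esym/eqP; rewrite -(expn0 p) eqn_exp2l ?prime_gt1 ?charF_prime //.
    by move=> e; case/negP: i0; apply/eqP/val_inj/eqP.
  by apply: contra_eq_neq => ->; rewrite coef0 eq_sym oner_eq0.
have := @max_poly_roots _ P (enum F) P0; rewrite -cardE enum_uniq => /(_ _ isT) K.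
have : (#|F| < size P)%N.
  apply: K; apply/allP => x _; rewrite rootE /P horner_sum.
  under eq_bigr => i _ do rewrite hornerXn.
  by have := H x; rewrite negbK.
rewrite ltnNge card_charF (leq_trans sP) // addn1.
by rewrite ltn_exp2l ?prime_gt1 ?charF_prime // prednK // degF_gt0.
Qed.

Lemma sum_chi : \sum_(x : F) chi R x = 0.
Proof.
have [a a0] := absTr_neq0.
have ca : chi R a != 1.
  rewrite chiE zetaF_neq1 // trRep_lt andbT lt0n.
  by apply: contra_neq a0 => e; rewrite -trRepE e.
have : (chi R a - 1) * \sum_(x : F) chi R x = 0.
  rewrite mulrBl mul1r mulr_sumr [X in _ - X](reindex_inj (addrI a)) /=.
  by under [X in _ - X]eq_bigr => i _ do rewrite chiD; rewrite subrr.
by move/eqP; rewrite mulf_eq0 subr_eq0 (negPf ca) => /eqP.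
Qed.

Lemma sum_chiM (b : F) : \sum_a chi R (a * b) = if b == 0 then #|F|%:R else 0.
Proof.
case: eqVneq => [->|b0].
  under eq_bigr => i _ do rewrite mulr0 chi0.
  by rewrite sumr_const.
rewrite -[RHS]sum_chi [RHS](reindex_inj (mulIf b0)) /=.
by [].
Qed.

Lemma sum_chiM_neq0 (b : F) :
  \sum_(a | a != 0) chi R (a * b) = (if b == 0 then #|F|%:R else 0) - 1.
Proof. by rewrite -sum_chiM [in RHS](bigD1 0) //= mul0r chi0 addrAC subrr add0r. Qed.

End Character.

(** * Gauss sums *)

Section DotProduct.
Variables (R : realType) (F : finFieldType) (d : nat).
Local Notation C := R[i].
Local Notation V := 'rV[F]_d.
Implicit Types x y z : V.

Lemma dotvC x y : dotv x y = dotv y x.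
Proof. by apply: eq_bigr => i _; rewrite mulrC. Qed.

Lemma dotvDl x y z : dotv (x + y) z = dotv x z + dotv y z.
Proof. by rewrite -big_split; apply: eq_bigr => i _; rewrite mxE mulrDl. Qed.

Lemma dotvDr x y z : dotv z (x + y) = dotv z x + dotv z y.
Proof. by rewrite !(dotvC z) dotvDl. Qed.

Lemma dotvZl a x y : dotv (a *: x) y = a * dotv x y.
Proof. by rewrite mulr_sumr; apply: eq_bigr => i _; rewrite mxE mulrA. Qed.

Lemma dotvZr a x y : dotv x (a *: y) = a * dotv x y.
Proof. by rewrite !(dotvC x) dotvZl. Qed.

Lemma dotvNl x y : dotv (- x) y = - dotv x y.
Proof. by rewrite -scaleN1r dotvZl mulN1r. Qed.

Lemma dotvNr x y : dotv x (- y) = - dotv x y.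
Proof. by rewrite -scaleN1r dotvZr mulN1r. Qed.

Lemma dotv0l x : dotv 0 x = 0.
Proof. by rewrite -(scale0r 0) dotvZl mul0r. Qed.

Definition dotvE := (dotvDl, dotvDr, dotvZl, dotvZr, dotvNl, dotvNr).

Lemma mem_sphere j x : (x \in sphere d j) = (dotv x x == j).
Proof. by rewrite inE. Qed.

Lemma sum_rV_prod (phi : 'I_d -> F -> C) :
  \sum_(x : V) \prod_i phi i (x 0 i) = \prod_i \sum_a phi i a.
Proof.
rewrite bigA_distr_bigA /=.
rewrite (reindex (fun f : {ffun 'I_d -> F} => \row_i f i)) /=.
  by apply: eq_bigr => f _; apply: eq_bigr => i _; rewrite mxE.
exists (fun x : V => [ffun i => x 0 i]) => [f _|x _].
  by apply/ffunP => i; rewrite ffunE mxE.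
by apply/rowP => i; rewrite mxE ffunE.
Qed.

Lemma chi_sum (I : finType) (f : I -> F) : chi R (\sum_i f i) = \prod_i chi R (f i).
Proof. exact: (big_morph (chi R (F := F)) (@chiD R F) (chi0 R F)). Qed.

Lemma sum_chi_dotv x :
  \sum_(m : V) chi R (dotv m x) = if x == 0 then #|F|%:R ^+ d else 0.
Proof.
rewrite /dotv; under eq_bigr => m _ do rewrite chi_sum.
rewrite (sum_rV_prod (fun i a => chi R (a * x 0 i))).
case: eqVneq => [->|x0].
  under eq_bigr => i _ do rewrite sum_chiM mxE eqxx.
  by rewrite prodr_const card_ord.
have [i xi] : exists i, x 0 i != 0.
  apply/existsP; apply: contraT; rewrite negb_exists => /forallP H.
  by case/eqP: x0; apply/rowP => i; rewrite mxE; apply/eqP; have := H i; rewrite negbK.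
by rewrite (bigD1 i) //= sum_chiM (negPf xi) mul0r.
Qed.

End DotProduct.

(** * Quadratic Gauss sums and the Fourier count of sphere points *)

Section GaussSums.
Variables (R : realType) (F : finFieldType).
Local Notation C := R[i].
Hypothesis oddF : odd #|F|.

Lemma two_neq0 : 2 != 0 :> F.
Proof.
rewrite -(dvdn_pcharf (charF_pchar F)) dvdn_prime2 ?charF_prime //.
apply/eqP => p2; move: oddF; rewrite card_charF p2 oddX /= orbF.
by rewrite eqn0Ngt degF_gt0.
Qed.

Lemma cardF_ge3 : (3 <= #|F|)%N.
Proof. by case: #|F| oddF (finNzRing_gt1 F) => [|[|[|]]]. Qed.

Lemma neqN (x : F) : x != 0 -> - x != x.
Proof. by move=> x0; rewrite -subr_eq0 -opprD oppr_eq0 -mulr2n -mulr_natl mulf_neq0 // two_neq0. Qed.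

Lemma nonsquare_exists : exists nu : F, forall x, x ^+ 2 != nu.
Proof.
suff /existsP[nu /forallP ?] : [exists nu : F, [forall x, x ^+ 2 != nu]] by exists nu.
apply: contraT; rewrite negb_exists => /forallP H.
have surj (y : F) : exists x : F, x ^+ 2 == y.
  by apply/existsP; move: (H y); rewrite negb_forall => /existsP [x]; rewrite negbK => xy; apply/existsP; exists x.
pose g y := xchoose (surj y).
have gK : cancel g (fun x => x ^+ 2) by move=> y; apply/eqP; exact: (xchooseP (surj y)).
have /bij_inj inj2 : bijective (fun x : F => x ^+ 2).
  have bg : bijective g by apply: injF_bij; apply: can_inj gK.
  by exists g => // x; have [y ->] : exists y, x = g y;
    [case: bg => h _ gh; exists (h x) | rewrite gK].
have /inj2 e : (-1) ^+ 2 = 1 ^+ 2 :> F by rewrite sqrrN.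
by have := neqN (oner_neq0 F); rewrite e eqxx.
Qed.

Definition nsol (a y : F) : nat := #|[set x : F | a * x ^+ 2 == y]|.

Lemma nsol_le2 (a y : F) : a != 0 -> (nsol a y <= 2)%N.
Proof.
rewrite /nsol => a0; case: (set_0Vmem [set x : F | a * x ^+ 2 == y]) => [->|[x]]; first by rewrite cards0.
rewrite inE => /eqP xy; apply: (@leq_trans #|[set x; - x]|); last first.
  by rewrite cards2; case: (_ != _).
apply/subset_leq_card/fintype.subsetP => z; rewrite !inE -xy => /eqP /(mulfI a0) /eqP.
by rewrite eqf_sqr.
Qed.

(** A nonzero [y] cannot be both a square and [nu] times a square, so the sum is at most 2 for each
    [y]; its total over [y] is [2 * #|F|], which forces equality everywhere. *)
Lemma nsol_nonsquare (nu y : F) : (forall x, x ^+ 2 != nu) ->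
  (nsol 1%R y + nsol nu y = 2)%N.
Proof.
move=> nsq; have nu0 : nu != 0 by have := nsq 0; rewrite expr0n eq_sym.
have total a : (\sum_z nsol a z = #|F|)%N.
  rewrite -sum1_card [RHS](partition_big (fun x => a * x ^+ 2) predT) //=.
  by apply: eq_bigr => z _; rewrite /nsol -sum1_card; apply: eq_bigl => x; rewrite inE.
have le2 z : (nsol 1%R z + nsol nu z <= 2)%N.
  case: (eqVneq z 0) => [->|z0].
    suff n0 a : a != 0 -> (nsol a 0%R <= 1)%N by rewrite (leq_add (n0 _ _) (n0 _ _)) ?oner_eq0.
    move=> a0; rewrite -(cards1 (0 : F)) subset_leq_card //; apply/fintype.subsetP => x.
    by rewrite !inE mulf_eq0 (negPf a0) expf_eq0.
  case: (set_0Vmem [set x : F | 1 * x ^+ 2 == z]) => [e|[x]].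
    by rewrite {1}/nsol e cards0 add0n nsol_le2.
  rewrite inE mul1r => /eqP xz; suff -> : nsol nu z = 0%N.
    by rewrite addn0 nsol_le2 // oner_eq0.
  apply/eqP; rewrite cards_eq0 -finset.subset0; apply/fintype.subsetP => w; rewrite !inE => /eqP wz.
  have w0 : w != 0 by apply: contra_neq z0 => w0; rewrite -wz w0 expr0n mulr0.
  by case/eqP: (nsq (x / w)); rewrite expr_div_n xz -wz mulfK // expf_neq0.
apply/eqP; rewrite eqn_leq le2 leqNgt; apply/negP => lt2.
have : (\sum_z (nsol 1%R z + nsol nu z) < \sum_(z : F) 2)%N.
  by rewrite (bigD1 y) //= [X in (_ < X)%N](bigD1 y) //= -addSn leq_add // leq_sum.
by rewrite big_split /= !total sum_nat_const muln2 addnn ltnn.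
Qed.

Definition gauss (a : F) : C := \sum_x chi R (a * x ^+ 2).

Lemma gauss_fiber (a b : F) :
  gauss (a * b) = \sum_z (nsol b z)%:R * chi R (a * z).
Proof.
rewrite /gauss (partition_big (fun x => b * x ^+ 2) predT) //=.
apply: eq_bigr => z _; rewrite mulr_natl -sumr_const.
apply: eq_big => [x|x /eqP <-]; first by rewrite inE.
by rewrite mulrA.
Qed.

(** By [nsol_nonsquare] the two sums add up to twice a complete sum of a nontrivial character. *)
Lemma gauss_nonsquare (nu a : F) : (forall x, x ^+ 2 != nu) -> a != 0 ->
  gauss (a * nu) = - gauss a.
Proof.
move=> nsq a0; apply/eqP; rewrite -addr_eq0 -{2}(mulr1 a) !gauss_fiber addrC -big_split /=.
under eq_bigr => z _ do rewrite -mulrDl -natrD nsol_nonsquare // mulrC.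
rewrite -mulr_suml; under eq_bigr => z _ do rewrite mulrC.
by rewrite sum_chiM (negPf a0) mul0r.
Qed.

Lemma normr_gauss (a : F) : a != 0 -> `|gauss a| ^+ 2 = #|F|%:R.
Proof.
move=> a0; rewrite sqr_normc.
have -> : (gauss a)^*%C = \sum_x chi R (- (a * x ^+ 2)).
  by rewrite rmorph_sum; apply: eq_bigr => x _; rewrite chiN.
rewrite mulr_sumr; under eq_bigr => x _ do rewrite mulr_suml.
(* With [x = u + y] the exponent becomes linear in [y], so only [u = 0] survives the sum over
   [y]. *)
under eq_bigr => y _ do rewrite (reindex_inj (addIr y)) /=.
rewrite exchange_big /=.
transitivity (\sum_u chi R (a * u ^+ 2) * \sum_y chi R (y * (2 * a * u))).
  apply: eq_bigr => u _; rewrite mulr_sumr; apply: eq_bigr => y _; rewrite -!chiD; congr chi; ring.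
under eq_bigr => u _ do rewrite sum_chiM.
rewrite (bigD1 0) //= big1 => [|u u0].
  by rewrite mulr0 eqxx expr0n /= mulr0 chi0 mul1r addr0.
by rewrite (negPf (mulf_neq0 (mulf_neq0 two_neq0 a0) u0)) mulr0.
Qed.

Variables (d : nat) (j : F).
Hypotheses (evend : ~~ odd d) (j0 : j != 0).
Local Notation V := 'rV[F]_d.
Local Notation q := #|F|.

Lemma sum_chi_quad (r : F) : \sum_(x : V) chi R (r * dotv x x) = gauss r ^+ d.
Proof.
under eq_bigr => x _ do rewrite /dotv mulr_sumr chi_sum.
rewrite (sum_rV_prod (fun _ a => chi R (r * (a * a)))) prodr_const card_ord.
by congr (_ ^+ _); apply: eq_bigr => a _; rewrite expr2.
Qed.

(* Replacing [r] by [r * nu] with [nu] a nonsquare changes the sign, as the exponent [d + 1] is odd. *)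
Lemma sum_gauss_lift : \sum_(r | r != 0) gauss r ^+ d * gauss (- (j * r)) = 0.
Proof.
have [nu nsq] := nonsquare_exists; have nu0 : nu != 0 by have := nsq 0; rewrite expr0n eq_sym.
set X := LHS; suff : X = - X.
  by move/eqP; rewrite -addr_eq0 -mulr2n mulrn_eq0 => /eqP.
rewrite {1}/X (reindex_inj (mulIf nu0)) /= -sumrN; apply: eq_big => [r|r].
  by rewrite mulf_eq0 (negPf nu0) orbF.
rewrite mulf_eq0 (negPf nu0) orbF => r0.
rewrite gauss_nonsquare // mulrA -mulNr gauss_nonsquare ?mulNr ?oppr_eq0 ?mulf_neq0 //.
by rewrite exprNn -signr_odd (negPf evend) mul1r mulrN.
Qed.

Lemma card_sphere_fourier :
  q%:R * #|sphere d j|%:R = q%:R ^+ d + \sum_(r | r != 0) chi R (- (r * j)) * gauss r ^+ d.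
Proof.
have -> : q%:R * #|sphere d j|%:R = \sum_(x : V) \sum_r chi R (r * (dotv x x - j)).
  under eq_bigr => x _ do rewrite sum_chiM subr_eq0.
  rewrite -big_mkcond /= sumr_const mulr_natr; congr (_ *+ _).
  by apply: eq_card => x; rewrite mem_sphere.
rewrite exchange_big (bigD1 0) //=; congr (_ + _).
  under eq_bigr => x _ do rewrite mul0r chi0.
  by rewrite sumr_const card_mx mul1n natrX.
apply: eq_bigr => r _; rewrite -sum_chi_quad mulr_sumr; apply: eq_bigr => x _.
by rewrite -chiD; congr chi; ring.
Qed.

Lemma card_sphere_dist :
  `|q%:R * #|sphere d j|%:R - q%:R ^+ d : C| <= q%:R * q%:R ^+ d./2.
Proof.
rewrite card_sphere_fourier addrAC subrr add0r.
apply: le_trans (ler_norm_sum _ _ _) _.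
have H (r : F) : r != 0 -> `|chi R (- (r * j)) * gauss r ^+ d| <= q%:R ^+ d./2.
  move=> r0; rewrite normrM normr_chi mul1r normrX.
  by rewrite -{1}(even_halfK evend) -mul2n exprM normr_gauss.
apply: le_trans (ler_sum _ H) _.
rewrite sumr_const -[X in X <= _]mulr_natl ler_wpM2r ?exprn_ge0 ?ler0n // ler_nat.
exact: max_card.
Qed.

End GaussSums.

(** * Incidence bounds *)

Section KernelBound.
Variables (R : realType) (I T Om : finType) (P : pred T) (om : T -> I -> Om).
Variables (K : Om -> I -> R) (K0 : I -> I -> R) (G : I -> R) (kappa : R).
Hypothesis P_gt0 : (0 < #|P|)%N.
Hypothesis kappa_gt0 : 0 < kappa.
Hypothesis K_om : forall t i i', P t -> G i != 0 -> K (om t i) i' = K0 i i'.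
Hypothesis om_inj : forall t i t' i', P t -> P t' -> G i != 0 -> G i' != 0 ->
  om t i = om t' i' -> (t, i) = (t', i').
Hypothesis K_orth : forall i i', G i != 0 -> G i' != 0 ->
  \sum_w K w i * K w i' = if i == i' then #|P|%:R * kappa ^+ 2 else 0.

(** On the support of [G] the points [om t i] are pairwise distinct, so no value of [Psi] is counted
    twice. *)
Lemma sum_over_orbits_le (Psi : Om -> R) : (forall w, 0 <= Psi w) ->
  \sum_(t | P t) \sum_(i | G i != 0) Psi (om t i) <= \sum_w Psi w.
Proof.
move=> Psi_ge0; pose A := [set ti : T * I | P ti.1 && (G ti.2 != 0)].
have omA_inj : {in A &, injective (fun ti => om ti.1 ti.2)}.
  by move=> [t i] [t' i']; rewrite !inE /= => /andP[? ?] /andP[? ?]; apply: om_inj.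
have -> : \sum_(t | P t) \sum_(i | G i != 0) Psi (om t i) = \sum_(ti in A) Psi (om ti.1 ti.2).
  by rewrite pair_big_dep /=; apply: eq_bigl => ti; rewrite inE.
rewrite -(big_imset Psi omA_inj) /= [X in X <= _]big_mkcond /=.
by apply: ler_sum => w _; case: ifP.
Qed.

(* The form [sum K0 i i' * G i * G i'] is spread over the [#|P|] copies [om t i] of each
   index, where Cauchy-Schwarz meets the orthogonality relation [K_orth]. *)
Lemma kernel_bound :
  \sum_i \sum_i' G i * G i' * K0 i i' <= kappa * \sum_i G i ^+ 2.
Proof.
pose Phi i := \sum_i' G i' * K0 i i'.
have sumPhi : \sum_(i | G i != 0) Phi i ^+ 2 <= kappa ^+ 2 * \sum_i G i ^+ 2.
  rewrite -(ler_pM2l (_ : 0 < #|P|%:R :> R)) ?ltr0n //.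
  apply: le_trans (_ : \sum_w (\sum_i' G i' * K w i') ^+ 2 <= _).
    apply: le_trans (sum_over_orbits_le _); last by move=> w; exact: sqr_ge0.
    rewrite mulr_natl -sumr_const; apply: ler_sum => t Pt; apply: ler_sum => i Gi.
    by rewrite /Phi; under eq_bigr => i' _ do rewrite -(K_om _ Pt Gi).
  rewrite le_eqVlt; apply/orP; left; apply/eqP; transitivity (\sum_i \sum_i' G i * G i' * \sum_w K w i * K w i').
    under eq_bigr => w _ do rewrite expr2 mulr_suml.
    rewrite exchange_big; apply: eq_bigr => i _ /=.
    under eq_bigr => w _ do rewrite mulr_sumr.
    rewrite exchange_big; apply: eq_bigr => i' _ /=.
    by rewrite mulr_sumr; apply: eq_bigr => w _; rewrite mulrACA.
  rewrite mulrA mulr_sumr; apply: eq_bigr => i _.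
  rewrite (bigD1 i) //= [X in _ + X]big1 => [|i' i'i].
    rewrite addr0; case: (eqVneq (G i) 0) => [->|Gi]; first by rewrite !mul0r expr0n mulr0.
    by rewrite K_orth // eqxx mulrC expr2.
  case: (eqVneq (G i) 0) => [->|Gi]; first by rewrite !mul0r.
  case: (eqVneq (G i') 0) => [->|Gi']; first by rewrite mulr0 mul0r.
  by rewrite K_orth // eq_sym (negPf i'i) mulr0.
have -> : \sum_i \sum_i' G i * G i' * K0 i i' = \sum_(i | G i != 0) G i * Phi i.
  rewrite [RHS]big_mkcond; apply: eq_bigr => i _; rewrite /Phi mulr_sumr.
  case: eqVneq => [->|_] /=; first by apply: big1 => i' _; rewrite !mul0r.
  by apply: eq_bigr => i' _; rewrite mulrA.
rewrite -(ler_pM2l kappa_gt0) [X in X <= _]mulr_sumr.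
(* AM-GM with weight [kappa], chosen so that both squares sum to at most
   [kappa ^+ 2 * \sum_i G i ^+ 2]. *)
apply: le_trans (_ : \sum_(i | G i != 0) (kappa ^+ 2 * G i ^+ 2 + Phi i ^+ 2) / 2 <= _).
  apply: ler_sum => i _; rewrite ler_pdivlMr //.
  by have := sqr_ge0 (kappa * G i - Phi i); nra.
rewrite -mulr_suml ler_pdivrMr // big_split /= -mulr_sumr.
have : \sum_(i | G i != 0) G i ^+ 2 <= \sum_i G i ^+ 2.
  by rewrite [X in X <= _]big_mkcond; apply: ler_sum => i _; case: ifP => // _; exact: sqr_ge0.
move: sumPhi; set X := \sum_(i | _) Phi i ^+ 2; set Z := \sum_i G i ^+ 2; set Y := \sum_(i | _) G i ^+ 2.
by move=> ? YZ; have := ler_wpM2l (sqr_ge0 kappa) YZ; lra.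
Qed.

End KernelBound.

(** * Orthogonality and collinearity kernels *)

Section Incidence.
Variables (R : realType) (F : finFieldType) (d : nat).
Hypothesis oddF : odd #|F|.
Hypothesis evend : ~~ odd d.
Local Notation C := R[i].
Local Notation V := 'rV[F]_d.
Local Notation q := (#|F|%:R : R).
Local Notation ind b := ((b : bool)%:R : R).

(** The indicator of [b = 0], scaled by [q] and centred to have mean zero: its character expansion
    lacks the zero frequency. *)
Definition incK (b : F) : R := q * ind (b == 0) - 1.

Lemma incKE (b : F) : (incK b)%:C%C = \sum_(t | t != 0) chi R (t * b).
Proof.
rewrite sum_chiM_neq0 /incK rmorphB rmorphM !rmorph_nat rmorph1.
by case: eqP => _; rewrite ?mulr1 ?mulr0.
Qed.

Lemma card_nonzero : #|[pred t : F | t != 0]| = #|F|.-1.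
Proof. by rewrite -(cardC1 0); apply: eq_card. Qed.

Lemma q_gt0 : 0 < q. Proof. by rewrite ltr0n (leq_trans _ (cardF_ge3 oddF)). Qed.

Lemma nonzero_gt0 : (0 < #|[pred t : F | (t != 0)%R]|)%N.
Proof. by rewrite card_nonzero -ltnS prednK (leq_trans _ (cardF_ge3 oddF)). Qed.

Lemma incK_form (I : finType) (G : I -> R) (b : I -> I -> F) :
  \sum_i \sum_i' G i * G i' * incK (b i i') =
  q * (\sum_i \sum_i' G i * G i' * ind (b i i' == 0)) - (\sum_i G i) ^+ 2.
Proof.
rewrite expr2 mulr_suml mulr_sumr -sumrB; apply: eq_bigr => i _.
rewrite !mulr_sumr -sumrB; apply: eq_bigr => i' _; rewrite /incK; ring.
Qed.

Lemma eqC_real (x y : R) : x%:C%C = y%:C%C -> x = y.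
Proof. by case. Qed.

(** [kernel_bound] with copies [t *: u] and [kappa = q ^ (d / 2)]. By the second hypothesis the
    support of [G] meets each line through 0 at most once; hence for distinct [u] in it the
    functions [incK (dotv w u)] of [w] are orthogonal, each of square norm [(q - 1) * q ^ d]. *)
Lemma orth_incidence (G : V -> R) :
  (forall u, G u != 0 -> u != 0) ->
  (forall s u, G u != 0 -> G (s *: u) != 0 -> s *: u = u) ->
  q * (\sum_u \sum_v G u * G v * ind (dotv u v == 0)) <=
    (\sum_u G u) ^+ 2 + q ^+ d./2 * \sum_u G u ^+ 2.
Proof.
move=> G0 Gprop; rewrite -lerBlDl -incK_form.
apply: (@kernel_bound R V F V [pred t | t != 0] (fun t u => t *: u)
         (fun w u => incK (dotv w u))); first exact: nonzero_gt0.
- by rewrite exprn_gt0 // q_gt0.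
- move=> t u v; rewrite inE => t0 _.
  by rewrite dotvZl /incK mulf_eq0 (negPf t0).
- move=> t u t' u'; rewrite !inE => t0 t'0 Gu Gu' e.
  have e' : (t'^-1 * t) *: u = u' by rewrite -scalerA e scalerA mulVf // scale1r.
  have uu' : u = u' by rewrite -{1}(Gprop _ _ Gu (_ : G ((t'^-1 * t) *: u) != 0)) ?e'.
  move: e; rewrite -uu' => /eqP; rewrite -subr_eq0 -scalerBl scaler_eq0 (negPf (G0 _ Gu)) orbF.
  by rewrite subr_eq0 => /eqP ->.
move=> u v Gu Gv; apply: eqC_real; rewrite rmorph_sum /=.
transitivity (\sum_(t | t != 0) \sum_(t' | t' != 0) \sum_(w : V) chi R (dotv w (t *: u + t' *: v))).
  under eq_bigr => w _ do rewrite rmorphM /= !incKE mulr_suml.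
  rewrite exchange_big; apply: eq_bigr => t _ /=.
  under eq_bigr => w _ do rewrite mulr_sumr.
  rewrite exchange_big; apply: eq_bigr => t' _ /=.
  by apply: eq_bigr => w _; rewrite -chiD dotvDr !dotvZr.
case: eqVneq => [<-|uv]; last first.
  apply: big1 => t t0; apply: big1 => t' t'0; rewrite sum_chi_dotv.
  case: eqP => // /eqP; rewrite addr_eq0 => /eqP e; case/eqP: uv.
  have e' : (- (t'^-1 * t)) *: u = v.
    by rewrite scaleNr -scalerA e scalerN scalerA mulVf // scale1r opprK.
  by rewrite -{1}(Gprop _ _ Gu (_ : G ((- (t'^-1 * t)) *: u) != 0)) ?e'.
transitivity (\sum_(t : F | t != 0) (#|F|%:R ^+ d : C)).
  apply: eq_bigr => t t0.
  under eq_bigr => t' _ do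
    rewrite sum_chi_dotv -scalerDl scaler_eq0 (negPf (G0 _ Gu)) orbF addrC addr_eq0.
  rewrite (bigD1 (- t)) ?oppr_eq0 //= eqxx big1 ?addr0 // => t' /andP[_ t't].
  by rewrite (negPf t't).
rewrite sumr_const rmorphM rmorph_nat !rmorphXn rmorph_nat /= -exprM muln2 even_halfK //.
by rewrite mulr_natl.
Qed.

Variable j : F.
Hypothesis j0 : j != 0.

(** Completing the square, with shifts by [m / (2 r)] in [z] and by [mu / (2 r)] in [s]. *)
Lemma sum_chi_square (r : F) (m : V) (mu : F) : r != 0 ->
  \sum_(z : V) \sum_s chi R (r * (dotv z z - j * s ^+ 2) + (dotv z m - j * s * mu)) =
  chi R (- (dotv m m - j * mu ^+ 2) / (4 * r)) * (gauss R r ^+ d * gauss R (- (j * r))).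
Proof.
move=> r0; have two0 := two_neq0 oddF; pose c := (2 * r)^-1.
rewrite (reindex_inj (addIr (- (c *: m)))) /=.
rewrite -sum_chi_quad /gauss mulr_suml mulr_sumr; apply: eq_bigr => z _.
rewrite (reindex_inj (addIr (- (c * mu)))) /= mulr_sumr mulr_sumr; apply: eq_bigr => s _.
rewrite -!chiD; congr chi; rewrite !dotvE (dotvC m z).
have four0 : 4 != 0 :> F by rewrite (natrM _ 2 2) mulf_neq0.
by rewrite /c; field; rewrite r0 four0 two0.
Qed.

(** A sphere point [x] is lifted to the multiples [(t *: x, t)] on the cone [H = 0] in dimension
    [d + 1], and the kernel is restricted to that cone. For the orthogonality relation the indicator
    of [H = 0] is expanded into frequencies [r]: those with [r != 0] cancel in total by
    [sum_gauss_lift], and [r = 0] leaves linear characters. *)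
Lemma quadric_incidence (G : V -> R) :
  (forall x, G x != 0 -> x \in sphere d j) ->
  q * (\sum_x \sum_y G x * G y * ind (dotv x y == j)) <=
    (\sum_x G x) ^+ 2 + q ^+ d./2 * \sum_x G x ^+ 2.
Proof.
move=> GS; rewrite -lerBlDl.
under [X in q * X]eq_bigr => x _ do under eq_bigr => y _ do rewrite -subr_eq0.
rewrite -(incK_form G (fun x y => dotv x y - j)).
pose H (w : V * F) := dotv w.1 w.1 - j * w.2 ^+ 2.
apply: (@kernel_bound R V F (V * F)%type [pred t | t != 0] (fun t u => (t *: u, t))
         (fun w u => ind (H w == 0) * incK (dotv w.1 u - j * w.2))); first exact: nonzero_gt0.
- by rewrite exprn_gt0 // q_gt0.
- move=> t u v; rewrite inE => t0 /GS; rewrite mem_sphere => /eqP uj.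
  have -> : H (t *: u, t) == 0 by rewrite /H /= !dotvE uj; apply/eqP; ring.
  have -> : dotv (t *: u) v - j * t = t * (dotv u v - j) by rewrite dotvZl; ring.
  by rewrite mul1r /incK mulf_eq0 (negPf t0).
- move=> t u t' u'; rewrite !inE => t0 _ _ _ [+ tt']; rewrite -tt' => e.
  by rewrite -(scale1r u) -(mulVf t0) -scalerA e scalerA mulVf // scale1r.
move=> x y Gx Gy; have := GS _ Gx; have := GS _ Gy; rewrite !mem_sphere => /eqP yj /eqP xj.
have qC0 : (#|F|%:R : C) != 0 by rewrite pnatr_eq0 -lt0n (leq_trans _ (cardF_ge3 oddF)).
apply: eqC_real; rewrite rmorph_sum /=; apply: (mulfI qC0).
pose E r t t' := \sum_(z : V) \sum_s chi R (r * (dotv z z - j * s ^+ 2) +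
   (dotv z (t *: x + t' *: y) - j * s * (t + t'))).
have Esum : \sum_r \sum_(t | t != 0) \sum_(t' | t' != 0) E r t t' =
    \sum_w #|F|%:R * (ind (H w == 0) * incK (dotv w.1 x - j * w.2) *
      (ind (H w == 0) * incK (dotv w.1 y - j * w.2)))%:C%C.
  transitivity (\sum_w \sum_r \sum_(t | t != 0) \sum_(t' | t' != 0)
      chi R (r * H w) * (chi R (t * (dotv w.1 x - j * w.2)) * chi R (t' * (dotv w.1 y - j * w.2)))).
    rewrite [RHS]exchange_big; apply: eq_bigr => r _ /=.
    rewrite [RHS]exchange_big; apply: eq_bigr => t _ /=.
    rewrite [RHS]exchange_big; apply: eq_bigr => t' _ /=.
    rewrite /E pair_bigA; apply: eq_bigr => -[z s] _ /=.
    by rewrite -!chiD; congr chi; rewrite /H /= !dotvE; ring.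
  apply: eq_bigr => w _.
  under eq_bigr => r _ do (under eq_bigr => t _ do rewrite -mulr_sumr -mulr_sumr; rewrite -mulr_sumr -mulr_suml).
  rewrite -mulr_suml sum_chiM -!incKE !rmorphM !rmorph_nat.
  by case: eqP => _; rewrite ?mulr1n ?mulr0n ?mul1r ?mul0r ?mulr0.
rewrite mulr_sumr -Esum.
rewrite (bigD1 0) //= [X in _ + X](_ : _ = 0) ?addr0; last first.
  (* Summed over [t'], the phase left by completing the square gives a factor [c] that depends
     neither on [r] nor on [t], so the Gauss factors can be summed over [r] alone. *)
  pose c : C := (if dotv x y == j then #|F|%:R else 0) - 1.
  transitivity (\sum_(r | r != 0) (\sum_(t : F | t != 0) c) *
      (gauss R r ^+ d * gauss R (- (j * r)))).
    apply: eq_bigr => r r0; rewrite mulr_suml; apply: eq_bigr => t t0.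
    transitivity (\sum_(t' | t' != 0) chi R (t' * (- (t * (dotv x y - j)) / (2 * r))) *
        (gauss R r ^+ d * gauss R (- (j * r)))).
      apply: eq_bigr => t' _; rewrite /E sum_chi_square //; congr (chi _ _ * _).
      have two0 := two_neq0 oddF.
      have four0 : 4 != 0 :> F by rewrite (natrM _ 2 2) mulf_neq0.
      by rewrite !dotvE xj yj (dotvC y x); field; rewrite r0 four0 two0.
    rewrite -mulr_suml sum_chiM_neq0 /c mulf_eq0 oppr_eq0 mulf_eq0 (negPf t0) /=.
    by rewrite invr_eq0 mulf_eq0 (negPf r0) (negPf (two_neq0 oddF)) !orbF subr_eq0.
  by rewrite -mulr_sumr sum_gauss_lift ?mulr0.
have E0 t t' : E 0 t t' = (if t *: x + t' *: y == 0 then #|F|%:R ^+ d else 0) *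
    (if t + t' == 0 then #|F|%:R else 0).
  rewrite -sum_chi_dotv -[t + t' == 0](_ : (- (j * (t + t')) == 0) = _); last first.
    by rewrite oppr_eq0 mulf_eq0 (negPf j0).
  rewrite -sum_chiM mulr_suml; apply: eq_bigr => z _; rewrite mulr_sumr.
  by apply: eq_bigr => s _; rewrite -chiD; congr chi; ring.
under eq_bigr => t _ do under eq_bigr => t' _ do rewrite E0.
case: eqVneq => [<-|xy]; last first.
  rewrite mulr0; apply: big1 => t t0; apply: big1 => t' t'0.
  case: (eqVneq (t + t') 0) => [/eqP|_]; last by rewrite mulr0.
  rewrite addrC addr_eq0 => /eqP ->; rewrite scaleNr -scalerBr scaler_eq0 (negPf t0) /=.
  by rewrite subr_eq0 (negPf xy) mul0r.
have x0 : x != 0 by apply: contra_neq j0 => x0; rewrite -xj x0 dotv0l.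
transitivity (\sum_(t : F | t != 0) (#|F|%:R ^+ d * #|F|%:R : C)).
  apply: eq_bigr => t t0.
  rewrite (bigD1 (- t)) ?oppr_eq0 //= -scalerDl subrr scale0r !eqxx [X in _ + X]big1 ?addr0 //.
  by move=> t' /andP[_ t't]; rewrite [t + t']addrC [t' + t == 0]addr_eq0 (negPf t't) mulr0.
rewrite sumr_const rmorphM rmorph_nat !rmorphXn rmorph_nat /= -exprM muln2 even_halfK //.
by rewrite -[LHS]mulr_natl mulrA [RHS]mulrC.
Qed.

End Incidence.

(** * Additive energy on the sphere *)

Section Energy.
Variables (R : realType) (F : finFieldType) (d : nat).
Local Notation V := 'rV[F]_d.
Local Notation q := (#|F|%:R : R).
Local Notation ind b := ((b : bool)%:R : R).
Implicit Types (h g k : V -> R) (P : rel V).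

Definition energy P h : R :=
  \sum_z \sum_u \sum_v h z * h (z + u) * h (z + v) * h (z + u + v) * ind (P u v).

(** What remains of [energy] once AM-GM has removed one of the four vertex weights. *)
Definition corner P g : R := \sum_z \sum_u \sum_v g z * g (z + u) * g (z + v) * ind (P u v).

(** The parallelogram is read from its vertex [z + u] instead of [z]. *)
Lemma flip_left (f : V -> V -> V -> R) :
  \sum_z \sum_u \sum_v f z u v = \sum_z \sum_u \sum_v f (z + u) (- u) v.
Proof.
rewrite exchange_big [RHS]exchange_big (reindex_inj oppr_inj) /=.
by apply: eq_bigr => u _; rewrite (reindex_inj (addIr u)).
Qed.

Lemma flip_right (f : V -> V -> V -> R) :
  \sum_z \sum_u \sum_v f z u v = \sum_z \sum_u \sum_v f (z + v) u (- v).
Proof.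
under eq_bigr => z _ do rewrite exchange_big.
by rewrite (flip_left (fun z v u => f z u v)); apply: eq_bigr => z _; rewrite exchange_big.
Qed.

Lemma big3D (f f' : V -> V -> V -> R) :
  \sum_z \sum_u \sum_v (f z u v + f' z u v) =
  \sum_z \sum_u \sum_v f z u v + \sum_z \sum_u \sum_v f' z u v.
Proof.
rewrite -big_split; apply: eq_bigr => z _; rewrite -big_split; apply: eq_bigr => u _.
by rewrite -big_split.
Qed.

Lemma big3Z c (f : V -> V -> V -> R) :
  \sum_z \sum_u \sum_v c * f z u v = c * \sum_z \sum_u \sum_v f z u v.
Proof.
rewrite mulr_sumr; apply: eq_bigr => z _; rewrite mulr_sumr; apply: eq_bigr => u _.
by rewrite mulr_sumr.
Qed.

Lemma ler_big3 (f f' : V -> V -> V -> R) :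
  (forall z u v, f z u v <= f' z u v) ->
  \sum_z \sum_u \sum_v f z u v <= \sum_z \sum_u \sum_v f' z u v.
Proof. by move=> ff'; do 3![apply: ler_sum => ? _]. Qed.

Lemma amgm2 (a b c e : R) : 0 <= a -> 0 <= b ->
  2 * (c * a * b * e) <= c ^+ 2 * (a * b) + e ^+ 2 * (a * b).
Proof. by move=> a0 b0; have := mulr_ge0 (mulr_ge0 a0 b0) (sqr_ge0 (c - e)); lra. Qed.

(** Each summand on the right omits one of the four letters. The right side minus the left is the
    first square below plus the second plus twice the third. *)
Lemma amgm4 (a b c e : R) :
  4 * (a ^+ 3 * b ^+ 3 * c ^+ 3 * e ^+ 3) <=
  (a ^+ 4 * b ^+ 4 * c ^+ 4 + b ^+ 4 * a ^+ 4 * e ^+ 4) +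
  (c ^+ 4 * e ^+ 4 * a ^+ 4 + e ^+ 4 * c ^+ 4 * b ^+ 4).
Proof.
have H1 := sqr_ge0 (a ^+ 2 * b ^+ 2 * (c ^+ 2 - e ^+ 2)).
have H2 := sqr_ge0 (c ^+ 2 * e ^+ 2 * (a ^+ 2 - b ^+ 2)).
have H3 := sqr_ge0 (a * b * c * e * (a * b - c * e)).
lra.
Qed.

(** AM-GM on the opposite vertices [z] and [z + u + v]; the reflection exchanging them shows that
    their squares contribute equally. *)
Lemma energy_le_sqr P h : (forall x, 0 <= h x) -> (forall u v, P (- u) (- v) = P u v) ->
  energy P h <= \sum_z h z ^+ 2 * \sum_u \sum_v h (z + u) * h (z + v) * ind (P u v).
Proof.
move=> h0 PN; set Y := (X in _ <= X).
pose f z u v := h z ^+ 2 * (h (z + u) * h (z + v)) * ind (P u v).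
have Yf : Y = \sum_z \sum_u \sum_v f z u v.
  apply: eq_bigr => z _; rewrite mulr_sumr; apply: eq_bigr => u _; rewrite mulr_sumr.
  by apply: eq_bigr => v _; rewrite mulrA.
have Yf' : Y = \sum_z \sum_u \sum_v f (z + v + u) (- u) (- v).
  by rewrite Yf flip_left flip_right.
rewrite -(ler_pM2l (_ : 0 < 2 :> R)) // -big3Z (_ : 2 * Y = Y + Y); last ring.
rewrite {1}Yf Yf' -big3D.
apply: ler_big3 => z u v; rewrite /f PN. have e1 : z + v + u - u = z + v by rewrite addrK.
have e2 : z + v + u - v = z + u by rewrite addrAC addrK.
rewrite e1 e2 (addrAC z v u) mulrA -mulrDl ler_wpM2r //.
by rewrite [h (z + v) * _]mulrC amgm2.
Qed.

(** [amgm4] produces four corners, one at each vertex of the parallelogram, and the flips show that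
    their sums agree. For [h = k ^ 3] the weight [k ^ 4] is [h ^ (4/3)]. *)
Lemma energy_le_corner P k : (forall u v, P (- u) v = P u v) -> (forall u v, P u (- v) = P u v) ->
  energy P (fun x => k x ^+ 3) <= corner P (fun x => k x ^+ 4).
Proof.
move=> PN PN'; rewrite /corner; set Y := (X in _ <= X).
pose f z u v := k z ^+ 4 * k (z + u) ^+ 4 * k (z + v) ^+ 4 * ind (P u v).
have Y1 : Y = \sum_z \sum_u \sum_v f (z + u) (- u) v by rewrite -flip_left.
have Y2 : Y = \sum_z \sum_u \sum_v f (z + v) u (- v) by rewrite -flip_right.
have Y3 : Y = \sum_z \sum_u \sum_v f (z + v + u) (- u) (- v) by rewrite Y1 flip_right.
rewrite -(ler_pM2l (_ : 0 < 4 :> R)) // -big3Z.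
have -> : 4 * Y = (\sum_z \sum_u \sum_v f z u v + \sum_z \sum_u \sum_v f (z + u) (- u) v) +
  (\sum_z \sum_u \sum_v f (z + v) u (- v) + \sum_z \sum_u \sum_v f (z + v + u) (- u) (- v)).
  by rewrite -Y1 -Y2 -Y3 -/Y; ring.
rewrite -!big3D.
apply: ler_big3 => z u v; rewrite /f !PN !PN'.
have e1 : z + v + u - u = z + v by rewrite addrK.
have e2 : z + v + u - v = z + u by rewrite addrAC addrK.
have e3 : z + u - u = z by rewrite addrK.
have e4 : z + v - v = z by rewrite addrK.
rewrite e1 e2 e3 e4 (addrAC z v u) mulrA -!mulrDl.
rewrite ler_wpM2r //; apply: le_trans (amgm4 _ _ _ _) _.
by rewrite le_eqVlt; apply/orP; left; apply/eqP; ring.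
Qed.

Lemma sum_shift h z : \sum_u h (z + u) = \sum_u h u.
Proof. by rewrite [RHS](reindex_inj (addrI z)). Qed.

Lemma energy_trueE h : energy (fun _ _ => true) h = \sum_v (\sum_z h z * h (z + v)) ^+ 2.
Proof.
rewrite [RHS](eq_bigr (fun v => \sum_z \sum_x h z * h (z + v) * (h x * h (x + v)))); last first.
  by move=> v _; rewrite expr2 mulr_suml; apply: eq_bigr => z _; rewrite mulr_sumr.
rewrite [RHS]exchange_big; apply: eq_bigr => z _ /=; rewrite exchange_big; apply: eq_bigr => v _ /=.
by rewrite [RHS](reindex_inj (addrI z)); apply: eq_bigr => u _ /=; ring.
Qed.

Lemma corner_cube P g : (forall x, 0 <= g x) -> corner P g <= (\sum_x g x) ^+ 3.
Proof.
move=> g0; apply: le_trans (_ : \sum_z \sum_u \sum_v g z * g (z + u) * g (z + v) <= _).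
  by apply: ler_big3 => z u v; case: (P u v); rewrite ?mulr1 // mulr0 !mulr_ge0.
rewrite le_eqVlt; apply/orP; left; apply/eqP; rewrite exprS mulr_suml.
apply: eq_bigr => z _; rewrite -(sum_shift g z) expr2 mulr_suml mulr_sumr.
apply: eq_bigr => u _; rewrite !mulr_sumr; apply: eq_bigr => v _; ring.
Qed.

Variable j : F.
Hypotheses (oddF : odd #|F|) (evend : ~~ odd d) (j0 : j != 0).

Definition iso (u : V) : bool := dotv u u == 0.
Definition isoL : rel V := fun u _ => iso u.
Definition isoR : rel V := fun _ v => iso v.
Definition noniso_orth : rel V := fun u v => [&& dotv u v == 0, ~~ iso u & ~~ iso v].

Section SphereSupported.
Variable h : V -> R.
Hypothesis h_ge0 : forall x, 0 <= h x.
Hypothesis hS : forall x, h x != 0 -> x \in sphere d j.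

Lemma energy_split :
  energy (fun _ _ => true) h <= energy noniso_orth h + 2 * energy isoL h.
Proof.
have -> : 2 * energy isoL h = energy isoL h + energy isoR h.
  rewrite mulr_natl mulr2n; congr (_ + _); apply: eq_bigr => z _; rewrite exchange_big.
  apply: eq_bigr => u _; apply: eq_bigr => v _; rewrite /isoL /isoR addrAC; ring.
rewrite -!big3D; apply: ler_big3 => z u v; set X := _ * h (z + u + v); rewrite -!mulrDr.
have [->|X0] := eqVneq X 0; first by rewrite !mul0r.
have X_ge0 : 0 <= X by rewrite !mulr_ge0.
apply: ler_wpM2l => //; move: X0; rewrite !mulf_eq0 !negb_or => /andP[/andP[/andP[hz hu] hv] hw].
(* The alternating sum of [dotv x x] over the four vertices is [2 * dotv u v], and all four values
   are [j]. *)
have uv : dotv u v == 0.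
  have : 2 * dotv u v = dotv (z + u + v) (z + u + v) - dotv (z + u) (z + u)
      - dotv (z + v) (z + v) + dotv z z.
    by rewrite !dotvE (dotvC v u) (dotvC u z) (dotvC v z); ring.
  have := hS hz; have := hS hu; have := hS hv; have := hS hw; rewrite !mem_sphere.
  move=> /eqP -> /eqP -> /eqP -> /eqP ->; rewrite subrr sub0r addNr => /eqP.
  by rewrite mulf_eq0 (negPf (two_neq0 oddF)).
rewrite /noniso_orth /isoL /isoR uv /=.
by case: (iso u); case: (iso v); rewrite /= ?addr0 ?add0r ?lerDl ?lerDr.
Qed.

Lemma sum_sqr_shift : \sum_v \sum_z (h z * h (z + v)) ^+ 2 = (\sum_z h z ^+ 2) ^+ 2.
Proof.
rewrite exchange_big [RHS]expr2 mulr_suml; apply: eq_bigr => z _ /=.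
under eq_bigr => v _ do rewrite exprMn.
by rewrite -mulr_sumr (sum_shift (fun x => h x ^+ 2)).
Qed.

(* For fixed [v] the isotropic sides [u] join collinear points [z], [z + u] of the sphere, both
   carrying the weight [h z * h (z + v)]; the main term then reassembles the full energy. *)
Lemma energy_isotropic :
  q * energy isoL h <= energy (fun _ _ => true) h + q ^+ d./2 * (\sum_x h x ^+ 2) ^+ 2.
Proof.
pose G v z := h z * h (z + v).
have e1 : energy isoL h = \sum_v \sum_z \sum_x G v z * G v x * ind (dotv z x == j).
  rewrite [RHS]exchange_big; apply: eq_bigr => z _ /=; rewrite exchange_big; apply: eq_bigr => v _ /=.
  rewrite [RHS](reindex_inj (addrI z)); apply: eq_bigr => u _ /=; rewrite /G.
  rewrite (_ : h z * h (z + u) * h (z + v) * _ = h z * h (z + v) * (h (z + u) * h (z + u + v))); last ring.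
  set X := h z * h (z + v) * (h (z + u) * h (z + u + v)).
  have [->|X0] := eqVneq X 0; first by rewrite !mul0r.
  (* As [z] and [z + u] lie on the sphere, [dotv u u = - (2 * dotv z u)]; so [u] is isotropic
     exactly when [dotv z (z + u) = j]. *)
  congr (_ * ind _); rewrite /isoL /iso; move: X0; rewrite !mulf_eq0 !negb_or.
  case/andP=> [/andP[/hS + _] /andP[/hS + _]]; rewrite !mem_sphere !dotvE (dotvC u z) => /eqP -> /eqP e.
  have -> : dotv u u = - (2 * dotv z u) + (j + dotv z u + (dotv z u + dotv u u)) - j by ring.
  rewrite e addrK oppr_eq0 mulf_eq0 (negPf (two_neq0 oddF)) /=.
  by rewrite -[RHS]subr_eq0 addrC addKr.
rewrite e1 energy_trueE -sum_sqr_shift !mulr_sumr -big_split; apply: ler_sum => v _ /=.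
apply: quadric_incidence => // x; rewrite mulf_eq0 negb_or => /andP[/hS //].
Qed.

(** Since [q >= 3], the isotropic main term [2 * E] is at most two thirds of [q * E]; absorbing it
    on the left triples the other terms, whence 3 and 6. *)
Lemma energy_le :
  q * energy (fun _ _ => true) h <=
  3 * (q * energy noniso_orth h) + 6 * (q ^+ d./2 * (\sum_x h x ^+ 2) ^+ 2).
Proof.
have q3 : 3 <= q by rewrite ler_nat cardF_ge3.
have H1 := energy_split; have H2 := energy_isotropic.
have E0 : 0 <= energy (fun _ _ => true) h by do 3![apply: sumr_ge0 => ? _]; rewrite !mulr_ge0.
move: H1 H2 E0; set E := energy _ h; set N := energy _ h; set I := energy _ h; set X := _ * _ ^+ 2.
move=> H1 H2 E0.
have H3 : q * E <= q * N + 2 * (E + X) by nra.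
by nra.
Qed.

(* Two non-isotropic chords of the sphere issuing from the same point [z] are proportional
   only if they are equal. *)
Lemma noniso_incidence z : z \in sphere d j ->
  q * (\sum_u \sum_v h (z + u) * h (z + v) * ind (noniso_orth u v)) <=
  (\sum_x h x) ^+ 2 + q ^+ d./2 * \sum_x h x ^+ 2.
Proof.
move=> zS; pose G u := h (z + u) * ind (~~ iso u).
have G0 u : 0 <= G u by rewrite mulr_ge0.
have Gle u : G u <= h (z + u) by rewrite /G; case: (~~ _); rewrite ?mulr1 ?mulr0.
have GP u : G u != 0 -> dotv u u != 0 /\ dotv u u = - (2 * dotv z u).
  rewrite mulf_eq0 negb_or pnatr_eq0 eqb0 negbK => /andP[/hS zu nu]; split=> //.
  move: zS zu; rewrite !mem_sphere !dotvE => /eqP -> /eqP; rewrite (dotvC u z) => e.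
  have -> : dotv u u = - (2 * dotv z u) + (j + dotv z u + (dotv z u + dotv u u)) - j by ring.
  by rewrite e addrK.
apply: le_trans (_ : (\sum_u G u) ^+ 2 + q ^+ d./2 * \sum_u G u ^+ 2 <= _); last first.
  rewrite -(sum_shift h z) -(sum_shift (fun x => h x ^+ 2) z); apply: lerD.
    by rewrite lerXn2r ?nnegrE ?sumr_ge0 ?ler_sum.
  by rewrite ler_wpM2l ?exprn_ge0 ?ler_sum // => u _; rewrite lerXn2r ?nnegrE.
rewrite (_ : \sum_u _ = \sum_u \sum_v G u * G v * ind (dotv u v == 0)); last first.
  apply: eq_bigr => u _; apply: eq_bigr => v _; rewrite /G /noniso_orth.
  by case: (iso u); case: (iso v); case: (_ == 0); rewrite /= ?mulr1 ?mulr0 ?mul0r.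
apply: orth_incidence => // [u /GP[]|s u /GP[uu e] /GP[]].
  by move=> uu _; apply: contra_neq uu => ->; rewrite dotv0l.
(* Both chords satisfy [dotv v v = - (2 * dotv z v)], where the left side scales by [s ^ 2] and the
   right side by [s]. *)
rewrite dotvZl !dotvZr => suu es; suff -> : s = 1 by rewrite scale1r.
have s0 : s != 0 by apply: contra_neq suu => ->; rewrite mul0r.
apply: (mulIf uu); apply: (mulfI s0); rewrite mul1r es e; ring.
Qed.

Lemma noniso_orthN u v : noniso_orth (- u) v = noniso_orth u v.
Proof. by rewrite /noniso_orth /iso !dotvE !opprK oppr_eq0. Qed.

Lemma noniso_orthNr u v : noniso_orth u (- v) = noniso_orth u v.
Proof. by rewrite /noniso_orth /iso !dotvE !opprK oppr_eq0. Qed.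

(** AM-GM in the form that squares one vertex, then the incidence bound for the two neighbours of
    each [z]. *)
Lemma energy_l2 :
  q * energy (fun _ _ => true) h <=
  3 * ((\sum_x h x ^+ 2) * (\sum_x h x) ^+ 2) + 9 * (q ^+ d./2 * (\sum_x h x ^+ 2) ^+ 2).
Proof.
apply: le_trans energy_le _.
have PN u v : noniso_orth (- u) (- v) = noniso_orth u v by rewrite noniso_orthN noniso_orthNr.
have N1 := energy_le_sqr h_ge0 PN.
have N2 : q * energy noniso_orth h <=
    (\sum_x h x ^+ 2) * ((\sum_x h x) ^+ 2 + q ^+ d./2 * \sum_x h x ^+ 2).
  apply: le_trans (ler_wpM2l _ N1) _ => //; rewrite [X in X <= _]mulr_sumr [X in _ <= X]mulr_suml; apply: ler_sum => z _.
  rewrite mulrCA; have [->|hz] := eqVneq (h z) 0; first by rewrite expr0n !mul0r.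
  by rewrite ler_wpM2l ?sqr_ge0 // noniso_incidence // hS.
lra.
Qed.

End SphereSupported.

(** The trivial bound: for [h = k ^ 3] the right side is the fourth power of the l^(4/3) norm of
    [h]. *)
Lemma energy_l43_cube k : (forall x, 0 <= k x) ->
  energy (fun _ _ => true) (fun x => k x ^+ 3) <= (\sum_x k x ^+ 4) ^+ 3.
Proof.
move=> k0; apply: le_trans (@energy_le_corner _ k _ _) _ => //.
by apply: corner_cube => x; rewrite exprn_ge0.
Qed.

(** AM-GM over all four vertices, then the incidence bound for [k ^ 4] around each [z]; the last
    term comes from the isotropic sides. *)
Lemma energy_l43 k : (forall x, 0 <= k x) -> (forall x, k x != 0 -> x \in sphere d j) ->
  q * energy (fun _ _ => true) (fun x => k x ^+ 3) <=
  3 * (\sum_x k x ^+ 4) ^+ 3 + 3 * (q ^+ d./2 * (\sum_x k x ^+ 4) * \sum_x k x ^+ 8) +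
  6 * (q ^+ d./2 * (\sum_x k x ^+ 6) ^+ 2).
Proof.
move=> k0 kS.
have kn n : (forall x, 0 <= k x ^+ n) by move=> x; rewrite exprn_ge0.
have kSn n : (0 < n)%N -> forall x, k x ^+ n != 0 -> x \in sphere d j.
  by move=> n0 x; rewrite expf_eq0 n0 => /kS.
apply: le_trans (energy_le (kn 3) (kSn 3 isT)) _.
under [X in _ + 6 * (_ * X ^+ 2)]eq_bigr => x _ do rewrite -exprM.
rewrite lerD2r.
have N1 := energy_le_corner k noniso_orthN noniso_orthNr.
have N2 : q * energy noniso_orth (fun x => k x ^+ 3) <=
    (\sum_x k x ^+ 4) * ((\sum_x k x ^+ 4) ^+ 2 + q ^+ d./2 * \sum_x k x ^+ 8).
  apply: le_trans (ler_wpM2l _ N1) _ => //.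
  rewrite [X in X <= _]mulr_sumr [X in _ <= X]mulr_suml; apply: ler_sum => z _.
  rewrite (_ : \sum_u _ = k z ^+ 4 * \sum_u \sum_v k (z + u) ^+ 4 * k (z + v) ^+ 4 *
    ind (noniso_orth u v)); last first.
    rewrite mulr_sumr; apply: eq_bigr => u _; rewrite mulr_sumr; apply: eq_bigr => v _; ring.
  rewrite mulrCA; have [->|kz] := eqVneq (k z ^+ 4) 0; first by rewrite !mul0r.
  rewrite ler_wpM2l // (_ : \sum_x k x ^+ 8 = \sum_x (k x ^+ 4) ^+ 2).
    exact: (noniso_incidence (kn 4) (kSn 4 isT) (kSn 4 isT _ kz)).
  by apply: eq_bigr => x _; rewrite -exprM.
set A := \sum_x k x ^+ 4 in N2 *; set B := \sum_x k x ^+ 8 in N2 *.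
by rewrite -mulrDr ler_pM2l // (le_trans N2) // le_eqVlt; apply/orP; left; apply/eqP; ring.
Qed.

End Energy.

(** * The L^4 norm and the energy *)

Section FourierEnergy.
Variables (R : realType) (F : finFieldType) (d : nat).
Local Notation C := R[i].
Local Notation V := 'rV[F]_d.
Local Notation q := (#|F|%:R : R).
Local Notation normc := (@Normc.normc R).

Definition fourier (f : V -> C) (m : V) : C := \sum_x f x * chi R (dotv m x).

Lemma normr_normc (z : C) : `|z| = (normc z)%:C%C. Proof. by []. Qed.

Lemma normc_ge0 (z : C) : 0 <= normc z.
Proof. by case: z => a b; exact: sqrtr_ge0. Qed.

Lemma fourier_sqr (f : V -> C) m :
  `|fourier f m| ^+ 2 = fourier (fun u => \sum_z f (z + u) * (f z)^*%C) m.
Proof.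
rewrite sqr_normc.
have -> : (fourier f m)^*%C = \sum_z (f z)^*%C * chi R (- dotv m z).
  by rewrite rmorph_sum; apply: eq_bigr => z _; rewrite chiN; exact: rmorphM.
rewrite mulr_sumr /fourier; under [RHS]eq_bigr => u _ do rewrite mulr_suml.
rewrite [RHS]exchange_big; apply: eq_bigr => z _ /=.
rewrite (reindex_inj (addrI z)) mulr_suml; apply: eq_bigr => u _ /=.
by rewrite mulrACA -chiD -dotvNr -dotvDr [z + u]addrC addrK.
Qed.

Lemma parseval (a : V -> C) :
  \sum_m `|fourier a m| ^+ 2 = #|F|%:R ^+ d * \sum_u `|a u| ^+ 2.
Proof.
under eq_bigr => m _ do rewrite fourier_sqr.
rewrite exchange_big /=; under eq_bigr => u _ do rewrite -mulr_sumr sum_chi_dotv.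
rewrite (bigD1 0) //= eqxx [X in _ + X]big1 => [|u /negPf ->]; last by rewrite mulr0.
rewrite addr0 mulrC; congr (_ * _); apply: eq_bigr => z _; by rewrite addr0 sqr_normc.
Qed.

(** The squared modulus of the transform is the transform of the autocorrelation of [f]. Parseval
    applies to the latter, which is dominated by the autocorrelation of [|f|]. *)
Lemma fourier_l4_energy (f : V -> C) :
  \sum_m normc (fourier f m) ^+ 4 <=
    q ^+ d * energy (fun _ _ => true) (fun x => normc (f x)).
Proof.
rewrite -lecR rmorph_sum rmorphM rmorphXn rmorph_nat /=.
rewrite (_ : \sum_m _ = \sum_m `|fourier (fun u => \sum_z f (z + u) * (f z)^*%C) m| ^+ 2); last first.
  apply: eq_bigr => m _; rewrite -fourier_sqr ger0_norm ?exprn_ge0 ?normr_ge0 //.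
  by rewrite rmorphXn -exprM.
rewrite parseval ler_wpM2l ?exprn_ge0 ?ler0n // energy_trueE rmorph_sum /=.
apply: ler_sum => u _; rewrite rmorphXn lerXn2r ?nnegrE ?normr_ge0 //.
  by rewrite lecR sumr_ge0 // => z _; rewrite mulr_ge0 ?normc_ge0.
rewrite rmorph_sum; apply: le_trans (ler_norm_sum _ _ _) _; apply: ler_sum => z _.
by rewrite normrM normcJ rmorphM mulrC.
Qed.

End FourierEnergy.

(** * The size of the sphere *)

Section SphereSize.
Variables (R : realType) (F : finFieldType) (d : nat) (j : F).
Hypotheses (oddF : odd #|F|) (evend : ~~ odd d) (d4 : (4 <= d)%N).
Local Notation q := (#|F|%:R : R).

Lemma card_sphere_bounds :
  2 * q ^+ d <= 3 * (q * #|sphere d j|%:R) /\ 3 * (q * #|sphere d j|%:R) <= 4 * q ^+ d.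
Proof.
have H : `|q * #|sphere d j|%:R - q ^+ d| <= q * q ^+ d./2.
  rewrite -lecR; have E (x : R) : `|x%:C%C| = `|x|%:C%C.
    by rewrite normc_def /= expr0n addr0 sqrtr_sqr.
  rewrite -E rmorphB !rmorphM !rmorphXn /= !rmorph_nat.
  exact: card_sphere_dist.
have q3 : 3 <= q by rewrite ler_nat cardF_ge3.
(* As [d >= 4], the error exponent [d / 2 + 1] leaves room for one more factor [q >= 3]. *)
have : 3 * (q * q ^+ d./2) <= q ^+ d.
  rewrite -exprS; apply: le_trans (_ : q ^+ d./2.+2 <= _).
    by rewrite [q ^+ _.+2]exprS ler_wpM2r ?exprn_ge0.
  rewrite ler_eXn2l; last by lra.
  lia.
by move: H; rewrite ler_norml => /andP[H1 H2] H; split; lra.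
Qed.

End SphereSize.

(** * Cutting at two heights *)

Section PowerComparison.
Variable R : realType.
Implicit Types t l a b : R.

Lemma powR_le_below t l a b : 0 <= t <= l -> 0 < l -> 0 < b <= a ->
  t `^ a <= t `^ b * l `^ (a - b).
Proof.
case/andP=> t0 tl l0 /andP[b0 ba]; have [->|t_neq0] := eqVneq t 0.
  by rewrite !powR0 ?mul0r // gt_eqF // (lt_le_trans b0).
have -> : t `^ a = t `^ b * t `^ (a - b) by rewrite -powRD ?t_neq0 ?implybT // addrC subrK.
by rewrite ler_wpM2l ?powR_ge0 // ge0_ler_powR ?nnegrE ?subr_ge0 // ltW.
Qed.

Lemma powR_le_above t l a b : 0 < l <= t -> a <= b -> t `^ a <= t `^ b * l `^ (a - b).
Proof.
case/andP=> l0 lt ab; have t0 := lt_le_trans l0 lt.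
have -> : t `^ a = t `^ b * t `^ (a - b) by rewrite -powRD ?(gt_eqF t0) ?implybT // addrC subrK.
rewrite ler_wpM2l ?powR_ge0 // -(opprB b a) !powRN lef_pV2 ?posrE ?powR_gt0 //.
by rewrite ge0_ler_powR ?nnegrE ?subr_ge0 // ltW.
Qed.

(** Stands in for Hölder when an L^p norm is compared with the critical one, at the cost of a
    constant. *)
Lemma powR_le_1D t a b : 0 <= t -> 0 < a <= b -> t `^ a <= 1 + t `^ b.
Proof.
move=> t0 /andP[a0 ab]; have [t1|/ltW t1] := leP t 1.
  have := @ge0_ler_powR _ a (ltW a0) t 1; rewrite !nnegrE powR1 => /(_ t0 ler01 t1) H.
  by rewrite (le_trans H) // lerDl powR_ge0.
by rewrite (le_trans (ler_powR t1 ab)) // lerDr.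
Qed.

End PowerComparison.

(** * The critical exponent *)

Section CriticalExponent.
Variables (R : realType) (d : nat).
Hypothesis d4 : (4 <= d)%N.

Definition half_dim : R := (d./2)%:R.
Local Notation K := half_dim.
Definition crit : R := 4 * K / (3 * K - 1).

Lemma half_dim_ge2 : 2 <= K.
Proof. by rewrite ler_nat -[2%N]/(4./2) half_leq. Qed.

Lemma dim_natr (evend : ~~ odd d) : d%:R = 2 * K.
Proof. by rewrite -natrM mul2n even_halfK. Qed.

Lemma crit_spec : (3 * K - 1) * crit = 4 * K.
Proof. by rewrite /crit mulrC divfK // gt_eqF //; have := half_dim_ge2; lra. Qed.

Lemma crit_bounds : 4 / 3 < crit <= 2.
Proof.
have K2 := half_dim_ge2; have D : 0 < 3 * K - 1 by lra.
by rewrite /crit ltr_pdivlMr // ler_pdivrMr //; apply/andP; split; lra.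
Qed.

Lemma critE : ~~ odd d -> 4 * d%:R / (3 * d%:R - 2) = crit.
Proof.
move=> evend; have K2 := half_dim_ge2; rewrite /crit (dim_natr evend).
by field; apply/andP; split; rewrite gt_eqF //; lra.
Qed.

End CriticalExponent.

(** * Energy of the large, middle and small values *)

Section Pieces.
Variables (R : realType) (F : finFieldType) (d : nat) (j : F).
Hypotheses (oddF : odd #|F|) (evend : ~~ odd d) (d4 : (4 <= d)%N) (j0 : j != 0).
Local Notation V := 'rV[F]_d.
Local Notation q := (#|F|%:R : R).
Local Notation K := (half_dim R d).
Local Notation crit := (crit R d).
Local Notation E := (energy (fun _ _ => true)).

Variable rho : R.
Hypotheses (rho_ge1 : 1 <= rho) (q_rho : q = rho `^ 4).
(* With [rho = q ^ (1/4)] one has [hi ^ crit = q ^ (d / 2)]: for a normalized level set at height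
   [hi] the trivial bound on the energy equals the incidence error. Moreover [lo = hi / sqrt q]. *)
Definition hi : R := rho `^ (3 * K - 1).
Definition lo : R := rho `^ (3 * K - 3).

Lemma rho_gt0 : 0 < rho. Proof. exact: lt_le_trans ltr01 rho_ge1. Qed.

Lemma rhoD a b : rho `^ a * rho `^ b = rho `^ (a + b).
Proof. by rewrite powRD // (gt_eqF rho_gt0) implybT. Qed.

Lemma rhoX a n : (rho `^ a) ^+ n = rho `^ (a * n%:R).
Proof. by rewrite -(powR_mulrn n (powR_ge0 rho a)) -(powRrM rho a). Qed.

Lemma q_half_rho : q ^+ d./2 = rho `^ (4 * K).
Proof. by rewrite q_rho rhoX. Qed.

Lemma rho_le a b : a <= b -> rho `^ a <= rho `^ b.
Proof. by apply: ler_powR; exact: rho_ge1. Qed.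

Lemma rho_pos a : 0 < rho `^ a. Proof. exact: powR_gt0 rho_gt0. Qed.

Lemma hi_gt0 : 0 < hi. Proof. exact: rho_pos. Qed.

Lemma lo_gt0 : 0 < lo. Proof. exact: rho_pos. Qed.

Lemma card_sphere_rho :
  2 / 3 * rho `^ (8 * K - 4) <= #|sphere d j|%:R <= 4 / 3 * rho `^ (8 * K - 4).
Proof.
have [] := card_sphere_bounds R j oddF evend d4.
have -> : q ^+ d = q * rho `^ (8 * K - 4).
  by rewrite q_rho rhoX rhoD (dim_natr R evend); congr (_ `^ _); ring.
rewrite !(mulrCA _ q) !ler_pM2l ?ltr0n ?(leq_trans _ (cardF_ge3 oddF)) // => H1 H2.
by apply/andP; split; lra.
Qed.

Variable h : V -> R.
Hypothesis h_ge0 : forall x, 0 <= h x.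
Hypothesis hS : forall x, h x != 0 -> x \in sphere d j.
Hypothesis h_norm : \sum_x h x `^ crit <= 3 * rho `^ (8 * K - 4).

Lemma sum_le_norm (phi : V -> R) c : 0 <= c ->
  (forall x, phi x <= h x `^ crit * c) -> \sum_x phi x <= 3 * rho `^ (8 * K - 4) * c.
Proof.
move=> c0 H; apply: le_trans (ler_sum _ (fun x _ => H x)) _.
by rewrite -mulr_suml ler_wpM2r.
Qed.

(** With the cube root, the powers 4/3, 2 and 8/3 of [h] become the integral powers 4, 6 and 8 of
    [k]. *)
Let k x := h x `^ 3^-1.

Let k_ge0 x : 0 <= k x. Proof. exact: powR_ge0. Qed.

Let k_exp x n : k x ^+ n = h x `^ (n%:R / 3).
Proof. by rewrite -powR_mulrn // /k -powRrM mulrC. Qed.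

Let k_cube : (fun x => k x ^+ 3) = h.
Proof. by apply/funext => x; rewrite k_exp divff // powRr1. Qed.

(** The target [rho ^ (24 K - 16)], common to all three ranges, is the order of [|S| ^ 4 / q ^ d].
    Above [hi] the trivial bound reaches it because [4/3 < crit]. *)
Lemma energy_large : (forall x, h x != 0 -> hi <= h x) -> E h <= 27 * rho `^ (24 * K - 16).
Proof.
move=> h_large; have /andP[c1 _] := crit_bounds R d4; have cs := crit_spec R d4.
rewrite -k_cube; apply: le_trans (energy_l43_cube k_ge0) _.
have H : \sum_x k x ^+ 4 <= 3 * rho `^ (8 * K - 4) * hi `^ (4 / 3 - crit).
  apply: sum_le_norm => [|x]; first exact: powR_ge0.
  rewrite k_exp; have [->|hx] := eqVneq (h x) 0.
    by rewrite !powR0 ?mul0r //; lra.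
  by apply: powR_le_above; [rewrite hi_gt0 h_large | exact: ltW].
have -> : 27 * rho `^ (24 * K - 16) = (3 * rho `^ (8 * K - 4) * hi `^ (4 / 3 - crit)) ^+ 3.
  rewrite /hi -(powRrM rho) -mulrA rhoD exprMn rhoX; congr (_ * _); first by rewrite -natrX.
  by congr (_ `^ _); rewrite mulrBr cs; field.
by rewrite lerXn2r // nnegrE ?mulr_ge0 ?powR_ge0 ?sumr_ge0 // => x _; rewrite exprn_ge0.
Qed.

Lemma sum_sqr_le : (forall x, h x <= hi) -> \sum_x h x ^+ 2 <= 3 * rho `^ (10 * K - 6).
Proof.
move=> h_hi; have /andP[c1 c2] := crit_bounds R d4; have cs := crit_spec R d4.
have -> : 3 * rho `^ (10 * K - 6) = 3 * rho `^ (8 * K - 4) * hi `^ (2 - crit).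
  rewrite /hi -(powRrM rho) -mulrA rhoD; congr (_ * _ `^ _); rewrite mulrBr cs; ring.
apply: sum_le_norm => [|x]; first exact: powR_ge0.
rewrite -powR_mulrn // powR_le_below ?h_ge0 ?h_hi ?hi_gt0 //.
by rewrite c2 andbT; lra.
Qed.

(** In [energy_l2] the sum of squares is controlled by the upper height and the plain sum by the
    lower one. *)
Lemma energy_middle : (forall x, h x <= hi) -> (forall x, h x != 0 -> lo <= h x) ->
  E h <= 162 * rho `^ (24 * K - 16).
Proof.
move=> h_hi h_lo; have /andP[c1 c2] := crit_bounds R d4; have cs := crit_spec R d4.
have A := sum_sqr_le h_hi.
have B : \sum_x h x <= 3 * rho `^ (7 * K - 3).
  apply: le_trans (_ : 3 * rho `^ (8 * K - 4) * lo `^ (1 - crit) <= _).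
    apply: sum_le_norm => [|x]; first exact: powR_ge0.
    have [hx|hx] := eqVneq (h x) 0; first by rewrite hx mulr_ge0 ?powR_ge0.
    by rewrite -[leLHS]powRr1 // powR_le_above ?lo_gt0 ?h_lo //; lra.
  (* The exponent obtained is [7 K - 7 + 2 crit], and [crit <= 2]. *)
  by rewrite /lo -(powRrM rho) -mulrA rhoD ler_wpM2l // rho_le //; lra.
rewrite -(ler_pM2l (rho_pos 4)) -q_rho.
apply: le_trans (energy_l2 oddF evend j0 h_ge0 hS) _; rewrite q_half_rho.
have A0 : 0 <= \sum_x h x ^+ 2 by rewrite sumr_ge0 // => x _; exact: sqr_ge0.
have B0 : 0 <= \sum_x h x by rewrite sumr_ge0.
have r0 a := ltW (rho_pos a).
have -> : q * (162 * rho `^ (24 * K - 16)) = 162 * rho `^ (24 * K - 12).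
  by rewrite q_rho mulrCA rhoD; congr (_ * _ `^ _); ring.
have H1 : (\sum_x h x ^+ 2) * (\sum_x h x) ^+ 2 <= 27 * rho `^ (24 * K - 12).
  have -> : 27 * rho `^ (24 * K - 12) = 3 * rho `^ (10 * K - 6) * (3 * rho `^ (7 * K - 3)) ^+ 2.
    rewrite exprMn rhoX mulrACA rhoD -natrX -natrM; congr (_ * _ `^ _); ring.
  by rewrite ler_pM ?exprn_ge0 // lerXn2r // nnegrE // mulr_ge0.
have H2 : rho `^ (4 * K) * (\sum_x h x ^+ 2) ^+ 2 <= 9 * rho `^ (24 * K - 12).
  have -> : 9 * rho `^ (24 * K - 12) = rho `^ (4 * K) * (3 * rho `^ (10 * K - 6)) ^+ 2.
    rewrite exprMn rhoX mulrCA rhoD -natrX; congr (_ * _ `^ _); ring.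
  by rewrite ler_wpM2l // lerXn2r // nnegrE // mulr_ge0.
lra.
Qed.

(** Without a lower bound on [h] the plain sum is out of reach. In [energy_l43] the l^(4/3) sum is
    controlled by the size of the sphere and the l^(8/3) sum by [lo]. *)
Lemma energy_small : (forall x, h x <= lo) -> E h <= 474 * rho `^ (24 * K - 16).
Proof.
move=> h_lo; have /andP[c1 c2] := crit_bounds R d4; have cs := crit_spec R d4.
have r0 a := ltW (rho_pos a).
have h_hi x : h x <= hi by rewrite (le_trans (h_lo x)) // rho_le //; lra.
have A := sum_sqr_le h_hi.
have k_sup x : k x != 0 -> x \in sphere d j.
  move=> kx; apply: hS; apply: contra_neq kx => hx.
  by rewrite /k hx powR0 // invr_eq0.
have A' : \sum_x k x ^+ 6 = \sum_x h x ^+ 2.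
  by apply: eq_bigr => x _; rewrite -[in RHS]k_cube -exprM.
(* On the sphere [h ^ (4/3) <= 1 + h ^ crit]; the constant is [4/3 + 3 <= 5]. *)
have B : \sum_x k x ^+ 4 <= 5 * rho `^ (8 * K - 4).
  have /andP[_ S1] := card_sphere_rho.
  apply: le_trans (_ : \sum_x ((x \in sphere d j)%:R + h x `^ crit) <= _).
    apply: ler_sum => x _; rewrite k_exp; have [hx|hx] := eqVneq (h x) 0.
      by rewrite hx powR0 ?addr_ge0 ?powR_ge0.
    by rewrite (hS hx) powR_le_1D // ltW // andbT; lra.
  have eS : \sum_x (x \in sphere d j)%:R = #|sphere d j|%:R :> R.
    by rewrite -sum1_card natr_sum [RHS]big_mkcond; apply: eq_bigr => x _; case: (x \in _).
  rewrite big_split /= eS; apply: le_trans (lerD S1 h_norm) _.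
  by have := r0 (8 * K - 4); lra.
have G : \sum_x k x ^+ 8 <= 3 * rho `^ (12 * K - 8).
  apply: le_trans (_ : 3 * rho `^ (8 * K - 4) * lo `^ (8 / 3 - crit) <= _).
    apply: sum_le_norm => [|x]; first exact: powR_ge0.
    by rewrite k_exp powR_le_below ?h_ge0 ?h_lo ?lo_gt0 //; lra.
  by rewrite /lo -(powRrM rho) -mulrA rhoD ler_wpM2l // rho_le //; lra.
rewrite -(ler_pM2l (rho_pos 4)) -q_rho -{1}k_cube.
apply: le_trans (energy_l43 oddF evend j0 k_ge0 k_sup) _; rewrite q_half_rho A'.
have s0 n : 0 <= \sum_x k x ^+ n by rewrite sumr_ge0 // => x _; exact: exprn_ge0.
have A0 : 0 <= \sum_x h x ^+ 2 by rewrite -A'.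
have -> : q * (474 * rho `^ (24 * K - 16)) = 474 * rho `^ (24 * K - 12).
  by rewrite q_rho mulrCA rhoD; congr (_ * _ `^ _); ring.
have H1 : (\sum_x k x ^+ 4) ^+ 3 <= 125 * rho `^ (24 * K - 12).
  have -> : 125 * rho `^ (24 * K - 12) = (5 * rho `^ (8 * K - 4)) ^+ 3.
    rewrite exprMn rhoX -natrX; congr (_ * _ `^ _); ring.
  by rewrite lerXn2r // nnegrE // mulr_ge0.
have H2 : rho `^ (4 * K) * (\sum_x k x ^+ 4) * (\sum_x k x ^+ 8) <= 15 * rho `^ (24 * K - 12).
  have -> : 15 * rho `^ (24 * K - 12) =
      rho `^ (4 * K) * (5 * rho `^ (8 * K - 4)) * (3 * rho `^ (12 * K - 8)).
    rewrite (_ : 24 * K - 12 = 4 * K + (8 * K - 4) + (12 * K - 8)) -?rhoD; ring.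
  by rewrite ler_pM ?mulr_ge0 // ler_wpM2l.
have H3 : rho `^ (4 * K) * (\sum_x h x ^+ 2) ^+ 2 <= 9 * rho `^ (24 * K - 12).
  have -> : 9 * rho `^ (24 * K - 12) = rho `^ (4 * K) * (3 * rho `^ (10 * K - 6)) ^+ 2.
    rewrite exprMn rhoX mulrCA rhoD -natrX; congr (_ * _ `^ _); ring.
  by rewrite ler_wpM2l // lerXn2r // nnegrE // mulr_ge0.
lra.
Qed.

End Pieces.

(** * The extension estimate *)

Section Extension.
Variables (R : realType) (F : finFieldType) (d : nat) (j : F).
Hypotheses (oddF : odd #|F|) (evend : ~~ odd d) (d4 : (4 <= d)%N) (j0 : j != 0).
Local Notation C := R[i].
Local Notation V := 'rV[F]_d.
Local Notation S := (sphere d j).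
Local Notation q := (#|F|%:R : R).
Local Notation K := (half_dim R d).
Local Notation p0 := (crit R d).
Local Notation rho := (q `^ (4^-1)).
Local Notation normc := (@Normc.normc R).

Lemma normcD (x y : C) : normc (x + y) <= normc x + normc y.
Proof. exact: le_normcD. Qed.

Lemma rho_ge1 : 1 <= rho.
Proof.
rewrite -[leLHS](powRr0 q); apply: ler_powR; last by rewrite invr_ge0.
by rewrite ler1n (leq_trans _ (cardF_ge3 oddF)).
Qed.

Lemma q_rho : q = rho `^ 4.
Proof. by rewrite -powRrM mulVf ?powRr1. Qed.

Lemma expr4D3 (a b c : R) : (a + b + c) ^+ 4 <= 27 * (a ^+ 4 + b ^+ 4 + c ^+ 4).
Proof.
have H x y z : (x + y + z) ^+ 2 <= 3 * (x ^+ 2 + y ^+ 2 + z ^+ 2) :> R.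
  by have := sqr_ge0 (x - y); have := sqr_ge0 (y - z); have := sqr_ge0 (x - z); lra.
rewrite !(exprM _ 2 2); have := H (a ^+ 2) (b ^+ 2) (c ^+ 2).
have X0 : 0 <= a ^+ 2 + b ^+ 2 + c ^+ 2 by rewrite !addr_ge0 ?sqr_ge0.
have : ((a + b + c) ^+ 2) ^+ 2 <= (3 * (a ^+ 2 + b ^+ 2 + c ^+ 2)) ^+ 2.
  by rewrite lerXn2r ?nnegrE ?sqr_ge0 ?mulr_ge0.
lra.
Qed.

(** Here [17901 = 27 * (27 + 162 + 474)]: the outer 27 is the cost of [expr4D3] for three pieces,
    the others are the energy constants of the pieces. *)
Lemma fourier_l4_bound (r : R) (f : V -> C) : 1 <= r -> q = r `^ 4 ->
  (forall x, f x != 0 -> x \in S) ->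
  \sum_x normc (f x) `^ p0 <= 3 * r `^ (8 * K - 4) ->
  \sum_m normc (fourier f m) ^+ 4 <= 17901 * r `^ (32 * K - 16).
Proof.
move=> r1 qr fS fnorm; have r0 := lt_le_trans ltr01 r1.
have K2 := half_dim_ge2 R d4.
pose piece (P : pred R) x := if P (normc (f x)) then f x else 0.
pose H := hi d r; pose L := lo d r.
have LH : L <= H by apply: ler_powR => //; lra.
pose f1 := piece (fun t => H < t); pose f2 := piece (fun t => L < t <= H).
pose f3 := piece (fun t => t <= L).
have f123 x : f x = f1 x + f2 x + f3 x.
  rewrite /f1 /f2 /f3 /piece; case: (leP (normc (f x)) L) => [xL|Lx].
    by rewrite ltNge (le_trans xL LH) !add0r.
  by case: leP => _; rewrite ?addr0 ?add0r.
have pS P x : normc (piece P x) != 0 -> x \in S.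
  rewrite /piece; case: ifP => _ pz; last by move: pz; rewrite Normc.normc0 eqxx.
  by apply: fS; apply: contra_neq pz => ->; exact: Normc.normc0.
have pnorm P : \sum_x normc (piece P x) `^ p0 <= 3 * r `^ (8 * K - 4).
  apply: le_trans fnorm; apply: ler_sum => x _; rewrite /piece; case: ifP => // _.
  rewrite Normc.normc0 powR0 ?powR_ge0 // gt_eqF //.
  by have /andP[c1 _] := crit_bounds R d4; lra.
have n0 P x : 0 <= normc (piece P x) by exact: normc_ge0.
have nz P x : normc (piece P x) != 0 -> P (normc (f x)) /\ normc (piece P x) = normc (f x).
  by rewrite /piece; case: ifP => // _; rewrite Normc.normc0 eqxx.
have nle (P : pred R) b x : 0 <= b -> (forall t, P t -> t <= b) -> normc (piece P x) <= b.
  by move=> b0 Pb; rewrite /piece; case: ifP => [/Pb //|_]; rewrite Normc.normc0.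
have H0 : 0 <= H by exact: powR_ge0.
have L0 : 0 <= L by exact: powR_ge0.
have E1 : energy (fun _ _ => true) (fun x => normc (f1 x)) <= 27 * r `^ (24 * K - 16).
  apply: (energy_large d4 r1 (n0 _) (pnorm _)) => x /nz[Hx ->]; exact: ltW.
have E2 : energy (fun _ _ => true) (fun x => normc (f2 x)) <= 162 * r `^ (24 * K - 16).
  apply: (energy_middle oddF evend d4 j0 r1 qr (n0 _) (pS _) (pnorm _)) => x.
    by apply: nle => // t /andP[].
  by case/nz => /andP[/ltW Lx _] ->.
have E3 : energy (fun _ _ => true) (fun x => normc (f3 x)) <= 474 * r `^ (24 * K - 16).
  apply: (energy_small oddF evend d4 j0 r1 qr (n0 _) (pS _) (pnorm _)) => x.
  exact: nle.
have qd : q ^+ d = r `^ (8 * K).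
  by rewrite qr -powR_mulrn ?powR_ge0 // -(powRrM r) (dim_natr R evend); congr (_ `^ _); ring.
have G (g : V -> C) c : energy (fun _ _ => true) (fun x => normc (g x)) <= c * r `^ (24 * K - 16) ->
    \sum_m normc (fourier g m) ^+ 4 <= c * r `^ (32 * K - 16).
  move=> Eg; apply: le_trans (fourier_l4_energy g) _.
  have -> : c * r `^ (32 * K - 16) = q ^+ d * (c * r `^ (24 * K - 16)).
    rewrite qd mulrCA -powRD ?(gt_eqF r0) ?implybT //; congr (_ * _ `^ _); ring.
  by apply: ler_wpM2l => //; exact: exprn_ge0.
apply: le_trans (_ : 27 * (\sum_m normc (fourier f1 m) ^+ 4 + \sum_m normc (fourier f2 m) ^+ 4 +
   \sum_m normc (fourier f3 m) ^+ 4) <= _); last first.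
  by have := G _ _ E1; have := G _ _ E2; have := G _ _ E3; lra.
rewrite -!big_split mulr_sumr; apply: ler_sum => m _ /=; apply: le_trans (expr4D3 _ _ _).
rewrite lerXn2r ?nnegrE ?normc_ge0 ?addr_ge0 ?normc_ge0 //.
have -> : fourier f m = fourier f1 m + fourier f2 m + fourier f3 m.
  by rewrite /fourier -!big_split; apply: eq_bigr => x _; rewrite {1}f123 !mulrDl.
by apply: le_trans (normcD _ _) _; rewrite lerD2r normcD.
Qed.

Lemma card_sphere_gt0 : 0 < #|S|%:R :> R.
Proof.
have /andP[H _] := card_sphere_rho j oddF evend d4 rho_ge1 q_rho.
by apply: lt_le_trans H; rewrite mulr_gt0 // powR_gt0 // (lt_le_trans ltr01 rho_ge1).
Qed.

Lemma norm_dm_extension (f : V -> C) :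
  norm_dm 4 (extension S f) =
  (#|S|%:R ^- 4 * \sum_m normc (fourier (fun x => if x \in S then f x else 0) m) ^+ 4) `^ 4^-1.
Proof.
congr (_ `^ _); rewrite mulr_sumr; apply: eq_bigr => m _.
rewrite powR_mulrn ?normc_ge0 // /extension Normc.normcM exprMn; congr (_ * _ ^+ _).
  by rewrite Normc.normcV exprVn -(rmorph_nat (real_complex R)) /= expr0n /= addr0 sqrtr_sqr ger0_norm.
congr normc; rewrite big_mkcond; apply: eq_bigr => x _.
by case: ifP => _; rewrite ?mul0r.
Qed.

Lemma norm_dm_scale (a : R) (f : V -> C) : 0 <= a ->
  norm_dm 4 (extension S (fun x => a%:C%C * f x)) = a * norm_dm 4 (extension S f).
Proof.
move=> a0; rewrite /norm_dm.
rewrite (_ : \sum_m _ = a ^+ 4 * \sum_m normc (extension S f m) `^ 4); last first.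
  rewrite mulr_sumr; apply: eq_bigr => m _; rewrite !powR_mulrn ?normc_ge0 // -exprMn.
  congr (_ ^+ _); rewrite (_ : extension S _ m = a%:C%C * extension S f m).
    by rewrite Normc.normcM /= expr0n /= addr0 sqrtr_sqr ger0_norm.
  rewrite /extension [RHS]mulrCA; congr (_ * _); rewrite mulr_sumr.
  by apply: eq_bigr => x _; rewrite mulrA.
rewrite powRM ?exprn_ge0 ?sumr_ge0 //; last by move=> *; exact: powR_ge0.
by rewrite -powR_mulrn // -powRrM mulfV // powRr1.
Qed.

(** The bound [|S| <= 4/3 * rho ^ (8 K - 4)] turns the hypothesis into the constant 3 used above;
    the lower bound [2/3] gives 18, since [17901 * (3/2) ^ 4 <= 18 ^ 4]. *)
Lemma extension_normalized (f : V -> C) :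
  \sum_(x in S) normc (f x) `^ p0 <= 2 * #|S|%:R -> norm_dm 4 (extension S f) <= 18.
Proof.
move=> fnorm; have S0 := card_sphere_gt0.
have /andP[SL SU] := card_sphere_rho j oddF evend d4 rho_ge1 q_rho.
have r0 := lt_le_trans ltr01 rho_ge1.
have /andP[c1 _] := crit_bounds R d4.
pose g := fun x : V => if x \in S then f x else 0; rewrite norm_dm_extension -/g.
have : \sum_m normc (fourier g m) ^+ 4 <= 17901 * rho `^ (32 * K - 16).
  apply: fourier_l4_bound; [exact: rho_ge1 | exact: q_rho | |].
    by move=> x; rewrite /g; case: ifP => //; rewrite eqxx.
  rewrite (_ : \sum_x _ = \sum_(x in S) normc (f x) `^ p0); last first.
    rewrite [RHS]big_mkcond; apply: eq_bigr => x _; rewrite /g; case: ifP => // _.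
    by rewrite Normc.normc0 powR0 // gt_eqF //; lra.
  by apply: le_trans fnorm _; have := powR_ge0 rho (8 * K - 4); lra.
have -> : rho `^ (32 * K - 16) = (rho `^ (8 * K - 4)) ^+ 4.
  by rewrite -powR_mulrn ?powR_ge0 // -(powRrM rho); congr (_ `^ _); ring.
have : (2 / 3 * rho `^ (8 * K - 4)) ^+ 4 <= #|S|%:R ^+ 4.
  by rewrite lerXn2r ?nnegrE ?mulr_ge0 ?powR_ge0.
rewrite exprMn; set X := (rho `^ _) ^+ 4 => HX HT.
have -> : 18 = ((18 : R) ^+ 4) `^ 4^-1.
  by rewrite -powR_mulrn // -powRrM mulfV // powRr1.
rewrite ge0_ler_powR ?nnegrE ?invr_ge0 ?exprn_ge0 //.
  by rewrite mulr_ge0 ?invr_ge0 ?exprn_ge0 // sumr_ge0 // => m _; rewrite exprn_ge0 // normc_ge0.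
rewrite mulrC ler_pdivrMr ?exprn_gt0 //.
have X0 : 0 <= X by rewrite exprn_ge0 // powR_ge0.
lra.
Qed.

Lemma extension_le_scale (a : R) (f : V -> C) : 0 < a ->
  \sum_(x in S) (normc (f x) / a) `^ p0 <= 2 * #|S|%:R ->
  norm_dm 4 (extension S f) <= 18 * a.
Proof.
move=> a0 H; pose g x := (a^-1)%:C%C * f x.
have -> : extension S f = extension S (fun x => a%:C%C * g x).
  congr extension; apply/funext => x; rewrite /g mulrA -rmorphM mulfV ?gt_eqF //.
  by rewrite rmorph1 mul1r.
rewrite norm_dm_scale ?(ltW a0) // (mulrC 18); apply: ler_wpM2l; first exact: ltW.
apply: extension_normalized.
apply: le_trans H; apply: ler_sum => x _; rewrite /g Normc.normcM /= expr0n /= addr0 sqrtr_sqr.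
by rewrite ger0_norm ?invr_ge0 ?(ltW a0) // mulrC.
Qed.

Lemma extension_vanishing (f : V -> C) : (forall x, x \in S -> f x = 0) ->
  norm_dm 4 (extension S f) = 0.
Proof.
move=> f0; rewrite norm_dm_extension big1 ?mulr0 ?powR0 ?invr_eq0 // => m _.
rewrite /fourier big1 ?Normc.normc0 ?expr0n // => x _.
by case: ifP => [/f0 ->|_]; rewrite mul0r.
Qed.

(** [f] is divided by its norm [a]. For finite [r] the inequality [t ^ crit <= 1 + t ^ r] then sums
    to at most [2 * |S|]; for [p = +oo] every term is at most 1. If [a = 0], then [f] vanishes on
    the sphere. *)
Lemma extension_bound (p : \bar R) (f : V -> C) : (p0%:E <= p)%E ->
  norm_dm 4 (extension S f) <= 18 * norm_sigma S p f.
Proof.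
have S0 := card_sphere_gt0; have /andP[c1 _] := crit_bounds R d4.
case: p => [r| _ | ] //=.
  rewrite lee_fin => cr; set T := \sum_(x in S) _; set a := powR _ _.
  have T0 : 0 <= T by apply: sumr_ge0 => x _; exact: powR_ge0.
  have r0 : 0 < r by lra.
  have aT : a `^ r = #|S|%:R^-1 * T.
    by rewrite /a -powRrM mulVf ?gt_eqF // powRr1 // mulr_ge0 // invr_ge0.
  have [a0|a0] := eqVneq a 0.
    rewrite a0 mulr0 extension_vanishing // => x xS; apply: Normc.eq0_normc.
    have : T = 0.
      apply/eqP; move: aT; rewrite a0 powR0 ?(gt_eqF r0) // => /esym/eqP.
      by rewrite mulf_eq0 invr_eq0 (gt_eqF S0).
    move/eqP; rewrite psumr_eq0 => [|y _]; last exact: powR_ge0.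
    by move/allP => /(_ x (mem_index_enum x)); rewrite xS /= powR_eq0 => /andP[/eqP].
  have {}a0 : 0 < a by rewrite lt_neqAle eq_sym a0 powR_ge0.
  apply: extension_le_scale => //.
  apply: le_trans (_ : \sum_(x in S) (1 + (normc (f x) / a) `^ r) <= _).
    apply: ler_sum => x _; apply: powR_le_1D; last by rewrite cr andbT; lra.
    by rewrite divr_ge0 ?normc_ge0 // ltW.
  rewrite big_split /= sumr_const.
  rewrite (_ : \sum_(x in S) _ = (a `^ r)^-1 * T); last first.
    rewrite mulr_sumr; apply: eq_bigr => x _.
    by rewrite powRM ?normc_ge0 ?invr_ge0 ?(ltW a0) // mulrC -powR_inv1 ?(ltW a0) // powRAC powR_inv1 ?powR_ge0.
  have T1 : 0 < T.
    by rewrite -(pmulr_rgt0 _ (_ : 0 < #|S|%:R^-1)) ?invr_gt0 // -aT powR_gt0.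
  by rewrite aT invfM invrK -mulrA mulVf ?gt_eqF // mulr1; lra.
set a := \big[_/_]_(_ in _) _.
have fa x : x \in S -> normc (f x) <= a by move=> xS; exact: le_bigmax_cond.
have a_ge0 : 0 <= a by exact: bigmax_ge_id.
have [a0|a0] := eqVneq a 0.
  rewrite a0 mulr0 extension_vanishing // => x xS; apply: Normc.eq0_normc.
  by apply/eqP; rewrite eq_le normc_ge0 andbT -a0 fa.
have {}a0 : 0 < a by rewrite lt_neqAle eq_sym a0.
apply: extension_le_scale => //.
apply: le_trans (_ : \sum_(x in S) 1 <= _); last by rewrite sumr_const; lra.
apply: ler_sum => x xS; have <- : 1 `^ p0 = 1 :> R by rewrite powR1.
apply: ge0_ler_powR; rewrite ?nnegrE //; first lra.
- by rewrite divr_ge0 ?normc_ge0.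
- by rewrite ler_pdivrMr // mul1r fa.
Qed.

End Extension.

(** * Sharpness *)

Section RootOfMinusOne.
Variable F : finFieldType.

(** With [#|F| = 4 m + 1], some unit [x] is not a root of ['X^(2 m) - 1], there being [4 m] units;
    then [x ^ (2 m) = -1]. *)
Lemma sqrt_minus_one : #|F| = 1 %[mod 4] -> exists i : F, i ^+ 2 = -1.
Proof.
move=> q1; pose m := (#|F| %/ 4)%N; have qm : #|F| = (4 * m).+1.
  by rewrite [LHS](divn_eq _ 4) q1 mulnC addn1.
have m0 : (0 < m)%N by rewrite lt0n; apply/eqP => m0; have := finNzRing_gt1 F; rewrite qm m0.
have [x x0 xm] : exists2 x : F, x != 0 & x ^+ (2 * m) != 1.
  have [/existsP[x /andP[]]|] := boolP [exists x : F, (x != 0) && (x ^+ (2 * m) != 1)]; first by exists x.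
  rewrite negb_exists => /forallP H; pose P : {poly F} := 'X^(2 * m) - 1.
  have sP : size P = (2 * m).+1 by rewrite size_XnsubC // muln_gt0.
  have P0 : P != 0 by rewrite -size_poly_eq0 sP.
  have := @max_poly_roots _ P [seq x : F <- enum F | x != 0] P0.
  rewrite filter_uniq ?enum_uniq // sP.
  have -> : size [seq x : F <- enum F | x != 0] = #|F|.-1.
    by rewrite -(cardC1 0) cardE /enum_mem -filter_predI; congr size; apply: eq_filter => x; rewrite /= !inE andbT.
  rewrite qm /= => H'; suff : (4 * m < (2 * m).+1)%N by lia.
  apply: H' => //; apply/allP => x; rewrite mem_filter => /andP[x0 _].
  by have := H x; rewrite x0 /= negbK rootE !hornerE => /eqP ->; rewrite subrr.
exists (x ^+ m); rewrite -exprM mulnC.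
have : (x ^+ (2 * m)) ^+ 2 = 1.
  apply: (mulfI x0); rewrite mulr1 -exprM -exprS (_ : (2 * m * 2).+1 = #|F|); last by rewrite qm; lia.
  exact: expf_card.
by move/eqP; rewrite sqrf_eq1 (negPf xm) => /eqP.
Qed.

End RootOfMinusOne.

(* Finite fields of order [l ^ 2] contain a square root of [-1]. *)
Lemma large_field_with_root (N : nat) :
  exists F : finFieldType, [/\ odd #|F|, (N < #|F|)%N & exists i : F, i ^+ 2 = -1].
Proof.
have [l Nl l_pr] := prime_above (maxn N 2).
have [F _ cF] := pPrimePowerField l_pr (isT : (0 < 2)%N).
have l_odd : odd l by case: (even_prime l_pr) => // l2; move: Nl; rewrite l2; lia.
exists F; split; rewrite ?cF.
- by rewrite oddX.
- by rewrite expnS expn1; nia.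
apply: sqrt_minus_one; rewrite cF; lia.
Qed.

(** * The isotropic flat as a test set *)

Section Sharpness.
Variables (R : realType) (F : finFieldType) (n : nat) (i : F).
Hypotheses (oddF : odd #|F|) (n0 : (0 < n)%N) (i2 : i ^+ 2 = -1).
Local Notation d := ((1 + n) + (1 + n))%N.
Local Notation V := 'rV[F]_d.
Local Notation C := R[i].
Local Notation q := (#|F|%:R : R).
Local Notation S := (sphere d (1 : F)).
Local Notation normc := (@Normc.normc R).

(** The contributions of [w] and [i *: w] to the dot product cancel. Thus [w] parametrizes a totally
    isotropic subspace of dimension [n = d / 2 - 1], and the image of [block] is its orthogonal
    complement, of dimension [n + 2]. *)
Definition block (z : 'rV[F]_1 * 'rV[F]_1 * 'rV[F]_n) : V :=
  row_mx (row_mx z.1.1 z.2) (row_mx z.1.2 (i *: z.2)).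

Lemma dotv_row_mx a b (x x' : 'rV[F]_a) (y y' : 'rV[F]_b) :
  dotv (row_mx x y) (row_mx x' y') = dotv x x' + dotv y y'.
Proof.
by rewrite /dotv big_split_ord /=; congr (_ + _); apply: eq_bigr => l _;
  rewrite ?row_mxEl ?row_mxEr.
Qed.

Lemma dotv_block z z' : dotv (block z) (block z') = dotv z.1.1 z'.1.1 + dotv z.1.2 z'.1.2.
Proof.
rewrite !dotv_row_mx dotvZl dotvZr mulrA -expr2 i2 mulN1r; ring.
Qed.

Lemma block_inj : injective block.
Proof.
move=> [[s t] w] [[s' t'] w'] /eq_row_mx[/eq_row_mx[/= -> ->] /eq_row_mx[/= -> _]].
by [].
Qed.

Definition base : 'rV[F]_1 := const_mx 1.
Definition isotropic_flat : {set V} := [set block (base, 0, w) | w in [set: 'rV[F]_n]].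

Lemma flat_inj : injective (fun w => block (base, 0, w)).
Proof. by move=> w w' /block_inj [/eqP]; rewrite ?eqxx // => /eqP. Qed.

Lemma dotv_base : dotv base base = 1.
Proof. by rewrite /dotv big_ord1 !mxE mulr1. Qed.

Lemma flat_sphere : isotropic_flat \subset S.
Proof.
apply/fintype.subsetP => _ /imsetP[w _ ->].
by rewrite mem_sphere dotv_block dotv_base dotv0l addr0.
Qed.

Definition flat_ind (x : V) : C := (x \in isotropic_flat)%:R.

Lemma sum_flat (T : nmodType) (phi : V -> T) :
  \sum_(x in S) (if x \in isotropic_flat then phi x else 0) = \sum_w phi (block (base, 0, w)).
Proof.
rewrite -big_mkcondr /= (eq_bigl (fun x => x \in isotropic_flat)); last first.
  by move=> x; case xA: (x \in isotropic_flat); rewrite ?andbF // (fintype.subsetP flat_sphere).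
rewrite big_imset /=; last by move=> w w' _ _; exact: flat_inj.
by apply: eq_bigl => w; rewrite inE.
Qed.

Lemma flat_norm (p : R) : p != 0 ->
  norm_sigma S p%:E flat_ind = (#|S|%:R^-1 * q ^+ n) `^ p^-1.
Proof.
move=> p0; rewrite /norm_sigma; congr (_ `^ _); congr (_ * _).
transitivity (\sum_(x in S) (if x \in isotropic_flat then 1 else 0 : R)).
  apply: eq_bigr => x _; rewrite /flat_ind.
  by case: ifP => _; rewrite ?Normc.normc1 ?powR1 // Normc.normc0 powR0.
by rewrite (sum_flat (fun _ => 1 : R)) sumr_const card_mx mul1n natrX.
Qed.

(** At such a frequency the phase is constant along the flat, so nothing cancels. *)
Lemma flat_extension z : normc (extension S flat_ind (block z)) = #|S|%:R^-1 * q ^+ n.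
Proof.
rewrite /extension Normc.normcM.
rewrite (_ : \sum_(x in S) _ = \sum_w chi R (dotv (block z) (block (base, 0, w)))); last first.
  rewrite -(sum_flat (fun x => chi R (dotv (block z) x))); apply: eq_bigr => x _.
  by rewrite /flat_ind; case: ifP => _; rewrite ?mul1r ?mul0r.
under eq_bigr => w _ do rewrite dotv_block /= (dotvC z.1.2) dotv0l addr0.
rewrite sumr_const card_mx mul1n; congr (_ * _).
  by rewrite Normc.normcV -(rmorph_nat (real_complex R)) /= expr0n /= addr0 sqrtr_sqr ger0_norm.
rewrite -[chi _ _ *+ _]mulr_natr Normc.normcM -(rmorph_nat (real_complex R)) /= expr0n /= addr0 sqrtr_sqr.
rewrite ger0_norm // natrX; have := normr_chi R (dotv z.1.1 base).
by rewrite normr_normc => -[->]; rewrite mul1r.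
Qed.

Lemma flat_extension_norm :
  (q ^+ n.+2 * (#|S|%:R^-1 * q ^+ n) ^+ 4) `^ 4^-1 <= norm_dm 4 (extension S flat_ind).
Proof.
have T0 : 0 <= #|S|%:R^-1 * q ^+ n by rewrite mulr_ge0 ?invr_ge0.
apply: ge0_ler_powR; rewrite ?nnegrE ?invr_ge0 //.
  by apply: sumr_ge0 => m _; exact: powR_ge0.
apply: le_trans (_ : \sum_(m in [set block z | z in [set: _]])
    normc (extension S flat_ind m) `^ 4 <= _); last first.
  by rewrite [X in X <= _]big_mkcond; apply: ler_sum => m _; case: ifP => // _; exact: powR_ge0.
rewrite big_imset /=; last by move=> z z' _ _; exact: block_inj.
under eq_bigr => z _ do rewrite flat_extension powR_mulrn //.
rewrite sumr_const cardsT !card_prod !card_mx !mul1n expn1 -[X in _ <= X]mulr_natl.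
by rewrite !natrM natrX [q ^+ n.+2]exprS exprS [q * (q * _)]mulrA.
Qed.

(** With [T] the ratio of the flat to the sphere, the hypothesis gives
    [q ^ ((n + 2) / 4) * T <= c * T ^ (1 / p)]. Then [T >= 1 / (2 q ^ (n + 1))] is inserted; the 2
    survives at most to the first power as [0 <= 1 - 1 / p <= 1]. *)
Lemma flat_test (p c : R) : 1 <= p -> 0 < c ->
  norm_dm 4 (extension S flat_ind) <= c * norm_sigma S p%:E flat_ind ->
  q `^ ((n%:R + 2) / 4 - (n%:R + 1) * (1 - p^-1)) <= 2 * c.
Proof.
move=> p1 c0; have p0 : p != 0 by rewrite gt_eqF // (lt_le_trans ltr01).
rewrite flat_norm //; move/(le_trans flat_extension_norm).
have q0 : 0 < q by rewrite ltr0n (leq_trans _ (cardF_ge3 oddF)).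
have evend : ~~ odd d by rewrite oddD addbb.
have d4 : (4 <= d)%N by lia.
have [SL SU] := card_sphere_bounds R (1 : F) oddF evend d4.
set s : R := #|S|%:R in SL SU *; set T := s^-1 * q ^+ n => H.
have dE : q ^+ d = q ^+ n.+1 * (q * q ^+ n) by rewrite -exprS -exprD.
have X0 : 0 < q ^+ n.+1 * q ^+ n by rewrite mulr_gt0 ?exprn_gt0.
move: SL SU; rewrite dE (mulrCA (q ^+ n.+1)) !(mulrCA _ q) !ler_pM2l // => SL SU.
have s0 : 0 < s by lra.
have T0 : 0 < T by rewrite mulr_gt0 ?invr_gt0 ?exprn_gt0.
have TL : (2 * q ^+ n.+1)^-1 <= T.
  rewrite -[leLHS]mul1r ler_pdivrMr ?mulr_gt0 ?exprn_gt0 //.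
  rewrite (_ : T * _ = 2 * (q ^+ n.+1 * q ^+ n) / s); last by rewrite /T; ring.
  by rewrite ler_pdivlMr //; lra.
have pV : 0 <= 1 - p^-1 <= 1.
  by rewrite subr_ge0 invf_le1 ?(lt_le_trans ltr01) // p1 gerBl invr_ge0 (le_trans ler01).
have T1 : q `^ ((n%:R + 2) / 4) * T `^ (1 - p^-1) <= c.
  have q1 := ltW q0; have T1 := ltW T0.
  move: H; rewrite powRM ?exprn_ge0 // -(powR_mulrn n.+2 q1) -(powRrM q).
  rewrite -(powR_mulrn 4 T1) -(powRrM T) mulfV // powRr1 //.
  have -> : n.+2%:R / 4 = (n%:R + 2) / 4 :> R by rewrite -addn2 natrD.
  by rewrite powRB ?(gt_eqF T0) ?implybT // powRr1 // mulrA ler_pdivrMr ?powR_gt0.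
apply: le_trans (_ : 2 * (q `^ ((n%:R + 2) / 4) * T `^ (1 - p^-1)) <= _); last by rewrite ler_pM2l.
have TL' : ((2 * q ^+ n.+1)^-1) `^ (1 - p^-1) <= T `^ (1 - p^-1).
  have /andP[? _] := pV.
  apply: ge0_ler_powR TL => //; rewrite nnegrE; last exact: ltW.
  by rewrite invr_ge0 mulr_ge0 ?exprn_ge0.
apply: le_trans (_ : 2 * (q `^ ((n%:R + 2) / 4) * ((2 * q ^+ n.+1)^-1) `^ (1 - p^-1)) <= _); last first.
  by rewrite ler_pM2l // ler_pM2l ?powR_gt0.
have B : 2^-1 * q `^ (- ((n%:R + 1) * (1 - p^-1))) <= ((2 * q ^+ n.+1)^-1) `^ (1 - p^-1).
  rewrite invfM powRM ?invr_ge0 ?exprn_ge0 //.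
  have -> : (q ^+ n.+1)^-1 `^ (1 - p^-1) = q `^ (- ((n%:R + 1) * (1 - p^-1))).
    rewrite -(powR_inv1 (exprn_ge0 _ (ltW q0))) -(powR_mulrn n.+1 (ltW q0)) -!(powRrM q) -natr1.
    by congr (_ `^ _); ring.
  rewrite ler_pM2r ?powR_gt0 // ger1_powR //; last by case/andP: pV.
  by rewrite invr_gt0 ltr0n /= invf_le1 // ler1n.
rewrite powRD ?(gt_eqF q0) ?implybT //.
have := ler_wpM2l (ltW (powR_gt0 ((n%:R + 2) / 4) q0)) B; lra.
Qed.
End Sharpness.

Theorem theorem1p5 (R : realType) (d : nat) :
  (4 <= d)%N -> ~~ odd d ->
  (forall p : \bar R,
     (((4 * d%:R) / (3 * d%:R - 2) : R)%:E <= p)%E ->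
     exists C : R, 0 < C /\
       forall (F : finFieldType), odd #|F| ->
       forall j : F, j != 0 ->
       forall f : 'rV[F]_d -> R[i],
         norm_dm 4 (extension (sphere d j) f) <= C * norm_sigma (sphere d j) p f)
  /\
  (forall p : R, 1 <= p -> p < (4 * d%:R) / (3 * d%:R - 2) ->
     ~ exists C : R, 0 < C /\
       forall (F : finFieldType), odd #|F| ->
       forall j : F, j != 0 ->
       forall f : 'rV[F]_d -> R[i],
         norm_dm 4 (extension (sphere d j) f) <= C * norm_sigma (sphere d j) p%:E f).
Proof.
move=> d4 evend; rewrite (critE R d4 evend); split=> [p pc|p p1 pc].
  by exists 18; split=> // F oddF j j0 f; exact: extension_bound.
move=> [c [c0 H]].
have [n dn] : exists n, d = ((1 + n) + (1 + n))%N.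
  exists d./2.-1; rewrite add1n prednK ?half_gt0 ?(leq_trans _ d4) //.
  by rewrite addnn even_halfK.
have n0 : (0 < n)%N by lia.
have p0 : 0 < p by rewrite (lt_le_trans ltr01).
pose e : R := (n%:R + 2) / 4 - (n%:R + 1) * (1 - p^-1).
(* Positivity of [e] is [p < crit] rewritten with [d = 2 (n + 1)]. *)
have e0 : 0 < e.
  have dK : half_dim R d = n%:R + 1.
    by rewrite /half_dim dn addnn doubleK natrD addrC.
  move: pc; rewrite /crit dK => pc.
  have D : 0 < 3 * (n%:R + 1) - 1 :> R by have : 0 <= n%:R :> R by []; lra.
  move: pc; rewrite ltr_pdivlMr // mulrC -ltr_pdivlMr // => pc.
  rewrite /e; lra.
(* A field with [q > (2 c) ^ (1 / e)] violates [q ^ e <= 2 c], which [flat_test] yields for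
   [j = 1]. *)
have M0 : 0 <= (2 * c) `^ e^-1 by exact: powR_ge0.
have [F [oddF qN [i i2]]] := large_field_with_root (Num.bound ((2 * c) `^ e^-1)).
have q_large : (2 * c) `^ e^-1 < #|F|%:R.
  by apply: lt_trans (archi_boundP M0) _; rewrite ltr_nat.
rewrite {}dn in H.
have := flat_test oddF n0 i2 p1 c0 (H F oddF 1 (oner_neq0 F) _).
rewrite -/e leNgt => /negP; apply.
have := gt0_ltr_powR e0 M0 (ltW (le_lt_trans M0 q_large)) q_large.
by rewrite -powRrM mulVf ?gt_eqF // powRr1 // mulr_ge0 // ltW.
Qed.
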